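(* Let $G$ be a connected graph on $n$ vertices with maximum degree $\Delta$ (with $\log_\Delta n>1$), and let $\lambda_2=\lambda_2(\tilde A_G)$ be the second largest eigenvalue of its normalized adjacency matrix. Then $$m_G\left(\left[\left(1-\frac{\log\log_\Delta n}{\log_\Delta n}\right)\lambda_2,\ \lambda_2\right]\right)=\widetilde{O}\left(n\cdot \frac{\Delta^{7/5}}{\log^{1/5} n}\right).$$ That is, there are absolute constants $C,n_0>0$ such that for all $n\ge n_0$ and all such $G$ the left-hand side is at most $C(\log\log n)^{C}\, n\,\Delta^{7/5}/\log^{1/5}n$.
   Context: Graphs are finite, undirected, and may have multiedges and self-loops. $A_G$ is the adjacency matrix (entries count edges), $D_G$ is the diagonal matrix of degrees (the degree of a vertex is the corresponding row sum of $A_G$, so each self-loop contributes one), and $\tilde A_G:=D_G^{-1/2}A_GD_G^{-1/2}$ is the normalized adjacency matrix, with eigenvalues $\lambda_1(\tilde A_G)\ge\lambda_2(\tilde A_G)\ge\dots\ge\lambda_n(\tilde A_G)$. For an interval $I$, $m_G(I)$ is the number of eigenvalues of $\tilde A_G$ in $I$, counted with multiplicity. Logarithms are natural unless a base is indicated. Asymptotics are as $n\to\infty$, uniformly in $\Delta$, and $\widetilde O(\cdot)$ suppresses factors polynomial in $\log\log n$. *)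

(* Defs.v *)
From mathcomp Require Import all_boot all_order all_algebra.
From mathcomp Require Import polyrcf.
From mathcomp Require Import reals exp.

Set Implicit Arguments.
Unset Strict Implicit.
Unset Printing Implicit Defensive.

Import Order.TTheory GRing.Theory Num.Theory.

Local Open Scope ring_scope.

(* An undirected multigraph on the vertex set 'I_n, given by its edge
   multiplicities: [emult i j] is the number of edges joining i and j if
   i != j, and [emult i i] is the number of self-loops at i. *)
Record multigraph (n : nat) := Multigraph {
  emult : 'I_n -> 'I_n -> nat;
  emult_sym : forall i j, emult i j = emult j i
}.

Definition adjacent n (G : multigraph n) : rel 'I_n :=
  fun i j => (0 < emult G i j)%N.

Definition graph_connected n (G : multigraph n) : Prop :=
  forall i j, connect (adjacent G) i j.

(* A row sum of the adjacency matrix: a self-loop contributes 1, not 2. *)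
Definition degree n (G : multigraph n) (i : 'I_n) : nat :=
  (\sum_(j < n) emult G i j)%N.

Definition max_degree n (G : multigraph n) : nat :=
  (\max_(i < n) degree G i)%N.

Section Spectrum.
Variable R : realType.

Definition adjacency_mx n (G : multigraph n) : 'M[R]_n :=
  \matrix_(i, j) (emult G i j)%:R.

Definition degree_invsqrt_mx n (G : multigraph n) : 'M[R]_n :=
  diag_mx (\row_i (Num.sqrt (degree G i)%:R)^-1).

Definition normalized_adjacency_mx n (G : multigraph n) : 'M[R]_n :=
  degree_invsqrt_mx G *m adjacency_mx G *m degree_invsqrt_mx G.

(* The real eigenvalues of M in nonincreasing order, each repeated according
   to its multiplicity as a root of the characteristic polynomial. For a
   symmetric M these are all n eigenvalues. *)
Definition spectrum n (M : 'M[R]_n) : seq R :=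
  sort >=%R
    (flatten [seq nseq (mup x (char_poly M)) x | x <- rootsR (char_poly M)]).

Lemma count_spectrum n (M : 'M[R]_n) (x : R) :
  count_mem x (spectrum M) = mup x (char_poly M).
Proof.
have p0 : char_poly M != 0 by rewrite monic_neq0 // char_poly_monic.
rewrite /spectrum (permP (permEl (perm_sort _ _))) count_flatten -map_comp.
rewrite (eq_map (g := fun y => if y == x then mup x (char_poly M) else 0%N));
  last by move=> y /=; rewrite count_nseq /=; case: eqVneq => [->|_];
          rewrite ?mul1n.
rewrite sumnE big_map -big_mkcond /= big_const_seq iter_addn_0.
have -> : count (eq_op^~ x) (rootsR (char_poly M)) = (root (char_poly M) x).
  have uniq_rts : uniq (rootsR (char_poly M)) by apply: uniq_roots.
  rewrite (count_uniq_mem x uniq_rts).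
  by rewrite -(roots_on_rootsR p0 x) in_itv.
by case: (boolP (root _ x)) => [_|/mupNroot->]; rewrite ?muln1.
Qed.

(* lambda i is the i-th largest eigenvalue of the normalized adjacency matrix,
   counted from i = 1. *)
Definition lambda n (G : multigraph n) (i : nat) : R :=
  nth 0 (spectrum (normalized_adjacency_mx G)) i.-1.

Definition eigen_count n (G : multigraph n) (I : interval R) : nat :=
  count (fun x => x \in I) (spectrum (normalized_adjacency_mx G)).

(* For b = 0 or b = 1 the value is 0, as [ln] is 0 there and 0^-1 = 0. *)
Definition logb (b x : R) : R := ln x / ln b.

End Spectrum.

(* Main.v *)
From mathcomp Require Import all_boot all_order all_algebra.
From mathcomp Require Import ring lra zify spectral complex.
From mathcomp Require Import boolp reals sequences exp.
Require Import Defs.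

Set Implicit Arguments.
Unset Strict Implicit.
Unset Printing Implicit Defensive.

Import Order.TTheory GRing.Theory Num.Theory.
Local Open Scope ring_scope.

(* Let N be the normalized adjacency matrix, k ~ (log_Delta n) / 16 and
   s ~ (log n / (Delta^7 loglog n))^(1/5).
   Balls of radius 2k whose principal submatrix has top eigenvalue above
   lambda2 have centers close to each other (otherwise two of them would span a
   plane on which the quadratic form exceeds lambda2), so there are at most
   about sqrt n such centers; delete them, together with about n loglog n / s
   random vertices.  For every other x, the closed walks of length 2k at x have
   total weight at most lambda2^(2k).  Those visiting more than s vertices are
   likely to be hit by the random deletion.  Those confined to a set S of at
   most s vertices have weight at most mu(S)^(2k), with mu(S) the top eigenvalue
   on S, and mu(S) can be increased s times by adding a neighbouring vertex to
   S while staying at most lambda2.  Each step gains a factor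
   1 + c / (Delta^4 s^5): if f is the Perron vector on S with maximum M, the
   Dirichlet energy along a path leaving S forces 1 - mu(S) >= M^2 / (2 s), and
   the flux of f out of S then forces a boundary value of order
   M / (Delta s^2).
   Hence the trace of the 2k-th power of the remaining submatrix is small, it
   has few eigenvalues near lambda2, and interlacing transfers this to N. *)

(** * Real spectral theorem *)

Definition qform (R : pzRingType) n (M : 'M[R]_n) (v : 'rV_n) : R :=
  (v *m M *m v^T) 0 0.

Definition sqnorm (R : pzRingType) n (v : 'rV[R]_n) : R := (v *m v^T) 0 0.

Lemma qformE (R : comPzRingType) n (M : 'M[R]_n) (v : 'rV_n) :
  qform M v = \sum_i \sum_j M i j * v 0 i * v 0 j.
Proof.
rewrite /qform mxE exchange_big; apply: eq_bigr => j _.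
rewrite !mxE big_distrl /=; apply: eq_bigr => i _.
by rewrite [v 0 i * _]mulrC.
Qed.

Lemma sqnormE (R : pzRingType) n (v : 'rV[R]_n) :
  sqnorm v = \sum_i v 0 i ^+ 2.
Proof. by rewrite /sqnorm mxE; apply: eq_bigr => i _; rewrite mxE expr2. Qed.

Section RealSpectralTheorem.
Variable R : rcfType.

Lemma sqnorm_ge0 n (v : 'rV[R]_n) : 0 <= sqnorm v.
Proof. by rewrite sqnormE sumr_ge0 // => i _; rewrite sqr_ge0. Qed.

Lemma sqnorm_eq0 n (v : 'rV[R]_n) : (sqnorm v == 0) = (v == 0).
Proof.
apply/eqP/eqP => [|->]; last by rewrite /sqnorm mul0mx mxE.
rewrite sqnormE => /eqP; rewrite psumr_eq0; last by move=> i _; apply: sqr_ge0.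
move/allP => v0; apply/rowP => i; rewrite mxE.
by have := v0 i (mem_index_enum i); rewrite /= sqrf_eq0 => /eqP.
Qed.

Lemma sqnorm_gt0 n (v : 'rV[R]_n) : (0 < sqnorm v) = (v != 0).
Proof. by rewrite lt_def sqnorm_ge0 andbT sqnorm_eq0. Qed.

Lemma sqnormZ n a (v : 'rV[R]_n) : sqnorm (a *: v) = a ^+ 2 * sqnorm v.
Proof. by rewrite !sqnormE mulr_sumr; apply: eq_bigr => i _; rewrite mxE exprMn. Qed.

(** An eigenvector exists over the algebraically closed field [R[i]]; [a] and [b] are its real and
    imaginary parts. Computing [a *m M *m b^T] in two ways by symmetry gives
    [Im z * (sqnorm a + sqnorm b) = 0], so the eigenvalue is real and whichever of [a], [b] is
    nonzero is a real eigenvector. *)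
Lemma symmetric_eigenvector n (M : 'M[R]_n.+1) :
  M^T = M -> exists a (v : 'rV_n.+1), v != 0 /\ v *m M = a *: v.
Proof.
move=> symM.
have [z /eigenvalueP[v vM vn0]] :=
  @eigenvalue_closed R[i] n.+1 (map_mx (real_complex R) M) isT.
set a := map_mx (@complex.Re R) v; set b := map_mx (@complex.Im R) v.
have aM : a *m M = complex.Re z *: a - complex.Im z *: b.
  apply/rowP => j; have /rowP/(_ j)/(congr1 (@complex.Re R)) := vM.
  rewrite !mxE raddf_sum /=.
  have -> : complex.Re (z * v 0 j) = complex.Re z * complex.Re (v 0 j)
     - complex.Im z * complex.Im (v 0 j) by case: z {vM}; case: (v 0 j).
  move=> <-; apply: eq_bigr => k _; rewrite !mxE.
  by case: (v 0 k) => x y /=; rewrite mulr0 subr0.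
have bM : b *m M = complex.Im z *: a + complex.Re z *: b.
  apply/rowP => j; have /rowP/(_ j)/(congr1 (@complex.Im R)) := vM.
  rewrite !mxE raddf_sum /=.
  have -> : complex.Im (z * v 0 j) = complex.Im z * complex.Re (v 0 j)
     + complex.Re z * complex.Im (v 0 j).
    by case: z {vM aM} => p q; case: (v 0 j) => x y /=; ring.
  move=> <-; apply: eq_bigr => k _; rewrite !mxE.
  by case: (v 0 k) => x y /=; ring.
have ab0 : (a != 0) || (b != 0).
  rewrite -negb_and; apply: contra vn0 => /andP[/eqP a0 /eqP b0].
  apply/eqP/rowP => j; move/rowP: a0 => /(_ j); move/rowP: b0 => /(_ j).
  by rewrite !mxE; case: (v 0 j) => x y /= -> ->.
have z0 : complex.Im z = 0.
  have E : a *m M *m b^T = (b *m M *m a^T)^T.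
    by rewrite !trmx_mul trmxK symM mulmxA.
  have Eab : b *m a^T = (a *m b^T)^T by rewrite trmx_mul trmxK.
  move: E; rewrite aM bM !mulmxBl !mulmxDl -!scalemxAl linearD /= !linearZ /= Eab trmxK.
  move/matrixP/(_ 0 0); rewrite !mxE; set X := \sum_j _ * (b^T) _ _; set Y := \sum_j _.
  rewrite [X in _ = _ * X + _](_ : _ = sqnorm a); last by rewrite /sqnorm !mxE.
  rewrite (_ : Y = sqnorm b); last by rewrite /sqnorm !mxE.
  have : 0 < sqnorm a + sqnorm b.
    by case/orP: ab0; rewrite -sqnorm_gt0 => ?; [apply: ltr_pwDl|apply: ltr_wpDl]; 
       rewrite ?sqnorm_ge0.
  move=> h e; have : complex.Im z * (sqnorm a + sqnorm b) = 0 by move: e; lra.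
  by move/eqP; rewrite mulf_eq0 => /orP[/eqP//|]; rewrite gt_eqF.
case/orP: ab0 => h; [exists (complex.Re z), a|exists (complex.Re z), b]; split=> //.
  by rewrite aM z0 scale0r subr0.
by rewrite bM z0 scale0r add0r.
Qed.

(* The Householder reflection exchanging [v] and the first basis vector. *)
Lemma orthogonal_first_row n (v : 'rV[R]_n.+1) :
  sqnorm v = 1 -> exists H : 'M_n.+1, H *m H^T = 1%:M /\ row 0 H = v.
Proof.
move=> v1; pose e : 'rV[R]_n.+1 := delta_mx 0 0; pose w := v - e.
have [w0|wn0] := eqVneq w 0.
  exists 1%:M; rewrite trmx1 mulmx1; split=> //.
  by rewrite row1 -/e; apply/esym/eqP; rewrite -subr_eq0 -/w w0.
have ww : w *m w^T = (sqnorm w)%:M by rewrite [LHS]mx11_scalar.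
have swn0 : sqnorm w != 0 by rewrite sqnorm_eq0.
pose c := 2 / sqnorm w; pose H : 'M_n.+1 := 1%:M - c *: (w^T *m w).
have HT : H^T = H by rewrite /H linearB /= trmx1 linearZ /= trmx_mul trmxK.
exists H; split.
  have WW : (w^T *m w) *m (w^T *m w) = sqnorm w *: (w^T *m w).
    by rewrite mulmxA -[w^T *m w *m w^T]mulmxA ww mul_mx_scalar -scalemxAl.
  rewrite HT /H; move: (w^T *m w) WW => W WW.
  rewrite mulmxBl mul1mx mulmxBr mulmx1 -scalemxAl -scalemxAr WW !scalerA.
  rewrite (_ : c * c * sqnorm w = c + c); last by rewrite /c; field.
  by rewrite scalerDl opprB addrK subrK.
(* As [v] and [e] are unit vectors, the projection of [e] on [w = v - e] is [- w / 2]; subtracting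
   twice this projection carries [e] to [v]. *)
have ev : e *m w^T = (- (sqnorm w / 2))%:M.
  rewrite [LHS]mx11_scalar; congr (_%:M).
  have ee : sqnorm e = 1.
    by rewrite /sqnorm /e trmx_delta mul_delta_mx mxE !eqxx.
  have e_vw : v = w + e by rewrite /w subrK.
  have : sqnorm v = sqnorm w + 2 * (e *m w^T) 0 0 + sqnorm e.
    rewrite e_vw /sqnorm linearD /= mulmxDl !mulmxDr.
    have -> : w *m e^T = (e *m w^T)^T by rewrite trmx_mul trmxK.
    by rewrite !mxE; ring.
  by rewrite v1 ee; lra.
rewrite rowE -/e /H mulmxBr mulmx1 -scalemxAr mulmxA ev mul_scalar_mx scalerA.
rewrite /c mulrN (_ : 2 / _ * _ = 1); last by field.
by rewrite scaleN1r opprK /w addrC subrK.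
Qed.

(** Induction on the dimension. In an orthonormal basis starting with a unit eigenvector, the first
    row of the matrix vanishes off the corner, hence by symmetry so does the first column, and the
    induction hypothesis applies to the remaining block. *)
Theorem symmetric_diagonalization n (M : 'M[R]_n) :
  M^T = M -> exists (Q : 'M_n) (d : 'rV_n),
    Q *m Q^T = 1%:M /\ M = Q^T *m diag_mx d *m Q.
Proof.
elim: n M => [|n IHn] M symM.
  exists 1%:M, 0; split; first by rewrite trmx1 mulmx1.
  by apply/matrixP => -[].
have [a [v [vn0 vM]]] := symmetric_eigenvector symM.
pose u := (Num.sqrt (sqnorm v))^-1 *: v.
have u1 : sqnorm u = 1.
  by rewrite sqnormZ exprVn sqr_sqrtr ?sqnorm_ge0 // mulVf // sqnorm_eq0.
have uM : u *m M = a *: u by rewrite -scalemxAl vM !scalerA mulrC.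
have [H [HH Hu]] := orthogonal_first_row u1.
have HtH : H^T *m H = 1%:M by apply: mulmx1C.
have [B defB] : exists B : 'M[R]_(1 + n), B = H *m M *m H^T by exists (H *m M *m H^T).
have symB : B^T = B by rewrite defB !trmx_mul trmxK symM mulmxA.
have rB : row 0 B = a *: delta_mx 0 0.
  by rewrite defB !row_mul Hu uM -scalemxAl -Hu -row_mul HH row1.
have B0 j : B 0 j = a * (j == 0)%:R.
  by have /rowP/(_ j) := rB; rewrite !mxE.
have BE : B = block_mx a%:M 0 0 (drsubmx B).
  rewrite -{1}[B]submxK; congr block_mx.
  - apply/matrixP => i j; rewrite !mxE (ord1 i) (ord1 j) lshift0 B0.
    by rewrite eqxx mulr1.
  - by apply/matrixP => i j; rewrite !mxE (ord1 i) lshift0 B0 mulr0.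
  - apply/matrixP => i j; rewrite !mxE (ord1 j) lshift0 -symB mxE B0.
    by rewrite mulr0.
have [|Q' [d' [QQ' BQ']]] := IHn (drsubmx B).
  by rewrite -[RHS]/(drsubmx B) -{2}symB trmx_drsub.
pose Q0 : 'M[R]_(1 + n) := block_mx 1%:M 0 0 Q'.
exists (Q0 *m H), (row_mx a%:M d'); split.
  rewrite trmx_mul mulmxA -[Q0 *m H *m H^T]mulmxA HH mulmx1 /Q0.
  rewrite (@tr_block_mx _ 1 n 1 n) (@mulmx_block _ 1 n 1 n 1 n).
  rewrite !trmx0 trmx1 !mul0mx !mulmx0.
  by rewrite !addr0 add0r mulmx1 QQ' -(@scalar_mx_block _ 1 n).
have -> : M = H^T *m B *m H.
  by rewrite defB !mulmxA HtH mul1mx -mulmxA HtH mulmx1.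
rewrite trmx_mul -!mulmxA; congr (_ *m _); rewrite !mulmxA; congr (_ *m _).
have -> : diag_mx (row_mx a%:M d' : 'rV_(1 + n)) =
    block_mx (diag_mx a%:M) 0 0 (diag_mx d') by exact: diag_mx_row.
rewrite BE /Q0 (@tr_block_mx _ 1 n 1 n) !(@mulmx_block _ 1 n 1 n 1 n).
rewrite !trmx0 trmx1 !mul0mx !mulmx0 !mulmx1 !mul1mx.
rewrite !addr0 !add0r -BQ' (_ : diag_mx a%:M = a%:M) ?mul0mx //.
by apply/matrixP => i j; rewrite !mxE (ord1 i) (ord1 j).
Qed.

End RealSpectralTheorem.

(** * Eigenvalue counts *)

Section SpectralConsequences.
Variables (R : realType) (n : nat) (M Q : 'M[R]_n) (d : 'rV[R]_n).
Hypotheses (QQ : Q *m Q^T = 1%:M) (MQ : M = Q^T *m diag_mx d *m Q).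

Let QtQ : Q^T *m Q = 1%:M. Proof. exact: mulmx1C. Qed.

Lemma char_poly_diagonalized : char_poly M = \prod_i ('X - (d 0 i)%:P).
Proof.
pose P := map_mx polyC Q.
have PP : P^T *m P = 1%:M.
  by rewrite /P map_trmx -map_mxM QtQ map_mx1.
have -> : \prod_i ('X - (d 0 i)%:P) = char_poly (diag_mx d).
  rewrite char_poly_trig ?diag_mx_is_trig //.
  by apply: eq_bigr => i _; rewrite mxE eqxx mulr1n.
rewrite /char_poly; have -> : char_poly_mx M = P^T *m char_poly_mx (diag_mx d) *m P.
  rewrite /char_poly_mx mulmxBr mulmxBl mul_mx_scalar -scalemxAl PP scalemx1.
  by rewrite MQ !map_mxM map_trmx.
rewrite !det_mulmx mulrC mulrA -det_mulmx.
by rewrite (mulmx1C PP) det1 mul1r.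
Qed.

(** Both sides are compared by multiplicity: [mup] of a product of linear factors counts the
    matching factors. This links the root-based [spectrum] to the diagonal entries used everywhere
    below. *)
Lemma perm_spectrum : perm_eq (spectrum M) [seq d 0 i | i <- enum 'I_n].
Proof.
apply/allP => x _ /=; rewrite count_spectrum char_poly_diagonalized.
rewrite -[\prod_i _]big_enum count_map /=; elim: (enum _) => [|i s IHs] /=.
  by rewrite big_nil mupNroot // /root hornerC oner_eq0.
rewrite big_cons mupM; first last.
- by rewrite prodf_seq_neq0; apply/allP => j _ /=; rewrite polyXsubC_eq0.
- by rewrite polyXsubC_eq0.
rewrite (eqP IHs) -{1}['X - _]expr1 mup_XsubCX eq_sym.
by case: (d 0 i == x); rewrite ?mul1n.
Qed.

Lemma count_spectrum_diagonalized (P : pred R) :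
  count P (spectrum M) = #|[pred i | P (d 0 i)]|.
Proof.
rewrite (permP perm_spectrum) count_map enumT cardE /enum_mem size_filter.
exact: eq_count.
Qed.

Lemma qform_diagonalized (v : 'rV[R]_n) :
  qform M v = \sum_i d 0 i * (v *m Q^T) 0 i ^+ 2.
Proof.
rewrite /qform MQ !mulmxA -mulmxA -[Q *m v^T]trmxK trmx_mul trmxK mxE.
apply: eq_bigr => i _; rewrite mul_mx_diag !mxE.
by rewrite mulrC mulrA -expr2 mulrC.
Qed.

Lemma sqnorm_diagonalized (v : 'rV[R]_n) : sqnorm v = \sum_i (v *m Q^T) 0 i ^+ 2.
Proof.
rewrite -sqnormE /sqnorm trmx_mul trmxK !mulmxA -[_ *m Q^T *m Q]mulmxA.
by rewrite QtQ mulmx1.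
Qed.

Lemma expmx_diagonalized k :
  M ^+ k = Q^T *m diag_mx (map_mx (fun x => x ^+ k) d) *m Q.
Proof.
elim: k => [|k IHk].
  have -> : diag_mx (map_mx (fun x => x ^+ 0) d) = 1%:M.
    by apply/matrixP => i j; rewrite !mxE expr0.
  by rewrite mulmx1 QtQ expr0.
rewrite exprS IHk {1}MQ -!mulmxE !mulmxA; congr (_ *m _).
rewrite -[_ *m Q *m Q^T]mulmxA QQ mulmx1 -mulmxA; congr (_ *m _).
apply/matrixP => i j; rewrite mul_diag_mx !mxE.
by rewrite exprS mulrnAr.
Qed.

Lemma expmx_diagonalized_diag k x :
  (M ^+ k) x x = \sum_i d 0 i ^+ k * Q i x ^+ 2.
Proof.
rewrite expmx_diagonalized mxE; apply: eq_bigr => i _.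
by rewrite mul_mx_diag !mxE expr2 mulrA [Q i x * _]mulrC.
Qed.

Lemma mxtrace_expmx_diagonalized k : \tr (M ^+ k) = \sum_i d 0 i ^+ k.
Proof.
rewrite expmx_diagonalized mxtrace_mulC mulmxA QQ mul1mx mxtrace_diag.
by apply: eq_bigr => i _; rewrite mxE.
Qed.

End SpectralConsequences.

(** * Variational principles of Courant-Fischer type *)

Section CourantFischer.
Variables (R : realType) (n : nat) (M : 'M[R]_n).
Hypothesis symM : M^T = M.

Lemma size_spectrum : size (spectrum M) = n.
Proof.
have [Q [d [QQ MQ]]] := symmetric_diagonalization symM.
by rewrite (perm_size (perm_spectrum QQ MQ)) size_map size_enum_ord.
Qed.

Lemma count_spectrum_le_mxtrace mu k : 0 <= mu ->
  (count (>= mu) (spectrum M))%:R * mu ^+ k.*2 <= \tr (M ^+ k.*2).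
Proof.
move=> mu0; have [Q [d [QQ MQ]]] := symmetric_diagonalization symM.
rewrite (mxtrace_expmx_diagonalized QQ MQ) (count_spectrum_diagonalized QQ MQ).
rewrite -mulr_natl mulr1 -sum1_card natr_sum mulr_suml.
rewrite [leRHS](bigID (fun i => mu <= d 0 i)) /= ler_wpDr //.
  by apply: sumr_ge0 => i _; rewrite -muln2 mulnC exprM exprn_ge0 ?sqr_ge0.
by apply: ler_sum => i ge_mu; rewrite mul1r lerXn2r ?nnegrE // (le_trans mu0).
Qed.

Lemma top_eigenvector : (0 < n)%N -> exists a (v : 'rV_n),
  [/\ v != 0, v *m M = a *: v & forall w, qform M w <= a * sqnorm w].
Proof.
move=> n0; have [Q [d [QQ MQ]]] := symmetric_diagonalization symM.
pose i0 := Ordinal n0; pose i := [arg max_(j > i0) d 0 j]%O.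
have dmax j : d 0 j <= d 0 i.
  by rewrite /i; case: arg_maxP => // i1 _ /(_ j isT).
exists (d 0 i), (row i Q); split.
- apply/eqP => r0; have /matrixP/(_ i i) := QQ.
  rewrite mxE (eq_bigr (fun=> 0)) ?sumr_const ?mul0rn => [|j _].
    by rewrite mxE eqxx => /esym/eqP; rewrite oner_eq0.
  by have /rowP/(_ j) := r0; rewrite !mxE => ->; rewrite mul0r.
- rewrite MQ -row_mul !mulmxA QQ mul1mx; apply/rowP => j.
  by rewrite mul_diag_mx !mxE.
- move=> w; rewrite (qform_diagonalized MQ) (sqnorm_diagonalized QQ) mulr_sumr.
  by apply: ler_sum => j _; rewrite ler_wpM2r ?sqr_ge0.
Qed.

(** Testing on the rows of [Q] shows that every eigenvalue is at most [a]. The difference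
    [a * sqnorm v - qform M v] is then a sum of nonnegative terms that is at most 0, so [v] has no
    component along eigenvalues other than [a]. *)
Lemma qform_max_eigenvector a (v : 'rV_n) :
  (forall w, qform M w <= a * sqnorm w) -> a * sqnorm v <= qform M v ->
  v *m M = a *: v.
Proof.
have [Q [d [QQ MQ]]] := symmetric_diagonalization symM => hle hge.
have dle i : d 0 i <= a.
  have := hle (row i Q).
  rewrite (qform_diagonalized MQ) (sqnorm_diagonalized QQ) -row_mul QQ.
  rewrite (bigD1 i) //= big1 => [|j ne]; last first.
    by rewrite !mxE eq_sym (negbTE ne) expr0n mulr0.
  rewrite [X in a * X](bigD1 i) //= big1 => [|j ne]; last first.
    by rewrite !mxE eq_sym (negbTE ne) expr0n.
  by rewrite !mxE eqxx expr1n !addr0 !mulr1.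
have c0 i : (a - d 0 i) * (v *m Q^T) 0 i = 0.
  have /eqP : \sum_i (a - d 0 i) * (v *m Q^T) 0 i ^+ 2 = 0.
    apply/eqP; rewrite eq_le sumr_ge0 ?andbT => [|j _]; last first.
      by rewrite mulr_ge0 ?sqr_ge0 ?subr_ge0.
    rewrite (eq_bigr _ (fun i _ => mulrBl _ _ _)) sumrB -mulr_sumr.
    by rewrite -(sqnorm_diagonalized QQ) -(qform_diagonalized MQ) subr_le0.
  rewrite psumr_eq0 => [|j _]; last by rewrite mulr_ge0 ?sqr_ge0 ?subr_ge0.
  move/allP/(_ i (mem_index_enum i)); rewrite /= mulf_eq0 sqrf_eq0 -mulf_eq0.
  by move/eqP.
have vE : v = v *m Q^T *m Q by rewrite -mulmxA (mulmx1C QQ) mulmx1.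
rewrite [in RHS]vE MQ !mulmxA scalemxAl; congr (_ *m Q).
apply/rowP => i; rewrite mul_mx_diag !mxE; have := c0 i; rewrite !mxE mulrBl.
by move/eqP; rewrite subr_eq0 => /eqP ->; rewrite mulrC.
Qed.

End CourantFischer.

(** Dimension count: the [p] columns of [B] impose at most [p] linear conditions on the row space of
    [V]. *)
Lemma exists_kernel_vector (F : fieldType) m n p (V : 'M[F]_(m, n)) (B : 'M_(n, p)) :
  (p < \rank V)%N -> exists v : 'rV_n, [/\ v != 0, (v <= V)%MS & v *m B = 0].
Proof.
move=> ltp; pose K := (V :&: kermx B)%MS.
have /rowV0Pn[v vK vn0] : K != 0.
  rewrite -mxrank_eq0 -lt0n -(ltn_add2l (\rank (V *m B))) addn0 mxrank_mul_ker.
  exact: leq_ltn_trans (rank_leq_col _) ltp.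
exists v; split=> //; first exact: submx_trans vK (capmxSl _ _).
by apply/sub_kermxP; apply: submx_trans vK (capmxSr _ _).
Qed.

Section CourantFischerCount.
Variables (R : realType) (n : nat) (M : 'M[R]_n).
Hypothesis symM : M^T = M.

(** These are the columns of the identity indexed by [P], so that the vanishing of the coordinates
    in [P] becomes a kernel condition for [exists_kernel_vector]. *)
Let select (P : pred 'I_n) : 'M[R]_(n, #|P|) :=
  \matrix_(i, j) (i == enum_val j)%:R.

Let select_eq0 P (v : 'rV_n) : v *m select P = 0 -> forall i, P i -> v 0 i = 0.
Proof.
move=> v0 i Pi; have /rowP/(_ (enum_rank_in Pi i)) := v0.
rewrite !mxE (bigD1 i) //= !mxE enum_rankK_in // eqxx mulr1 big1 ?addr0 // => j.
by move=> ji; rewrite mxE enum_rankK_in // (negbTE ji) mulr0.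
Qed.

(** Otherwise some nonzero vector of [V] is orthogonal to all eigenvectors with eigenvalue above
    [mu], and its form is at most [mu] times its squared norm. *)
Lemma rank_le_count_gt mu m (V : 'M[R]_(m, n)) :
  (forall v : 'rV_n, (v <= V)%MS -> v != 0 -> mu * sqnorm v < qform M v) ->
  (\rank V <= count (> mu) (spectrum M))%N.
Proof.
move=> Vgt; have [Q [d [QQ MQ]]] := symmetric_diagonalization symM.
rewrite (count_spectrum_diagonalized QQ MQ) leqNgt; apply/negP.
case/(exists_kernel_vector (Q^T *m select _)) => v [vn0 vV].
rewrite mulmxA => /select_eq0 v0; have := Vgt v vV vn0; apply/negP; rewrite -leNgt.
rewrite (qform_diagonalized MQ) (sqnorm_diagonalized QQ) mulr_sumr.
apply: ler_sum => i _; case: (lerP (d 0 i) mu) => [le|gt].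
  by rewrite ler_wpM2r ?sqr_ge0.
by rewrite v0 // expr0n !mulr0.
Qed.

(** If the bound failed, the span of the eigenvectors of [M] selected by [P] would contain a nonzero
    [v] that vanishes on [S] and is orthogonal to the eigenvectors of [N] with eigenvalue at least
    [mu]. Then [qform N v < mu * sqnorm v <= qform M v], although the two forms agree at [v]. *)
Lemma count_interlacing (N : 'M[R]_n) (S : {set 'I_n}) (P : pred R) mu :
  N^T = N ->
  (forall x, P x -> mu <= x) ->
  (forall v : 'rV_n, (forall i, i \in S -> v 0 i = 0) -> qform N v = qform M v) ->
  (count P (spectrum M) <= #|S| + count (>= mu) (spectrum N))%N.
Proof.
move=> symN Pmu MN; have [Q [d [QQ MQ]]] := symmetric_diagonalization symM.
have [Q' [d' [QQ' NQ]]] := symmetric_diagonalization symN.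
rewrite (count_spectrum_diagonalized QQ MQ) (count_spectrum_diagonalized QQ' NQ).
set T := [pred i | P _]; set T' := [pred i | mu <= _].
pose E := (select T)^T *m Q.
have QtQ := mulmx1C QQ.
have rE : \rank E = #|T|.
  have sT : (select T)^T *m select T = 1%:M.
    apply/matrixP => i j; rewrite !mxE (bigD1 (enum_val i)) //= !mxE eqxx mul1r.
    rewrite big1 ?addr0 => [|k ki]; last by rewrite !mxE (negbTE ki) mul0r.
    by rewrite (inj_eq enum_val_inj).
  apply/eqP; rewrite eqn_leq rank_leq_row /= -{1}(mxrank1 R #|T|) -sT.
  rewrite -[(select T)^T]mulmx1 -QQ mulmxA -/E -mulmxA; exact: mxrankM_maxl.
rewrite -rE leqNgt; apply/negP => lt.
have [v [vn0 vE]] := exists_kernel_vector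
  (row_mx (select (mem S)) (Q'^T *m select T')) lt.
rewrite mul_mx_row => e0.
have [v1 v2] : v *m select (mem S) = 0 /\ v *m (Q'^T *m select T') = 0.
  by move: e0; rewrite -row_mx0 => /eq_row_mx.
have {}v1 := select_eq0 v1; rewrite mulmxA in v2; have {}v2 := select_eq0 v2.
have := MN v v1; apply/eqP; rewrite lt_eqF //.
apply: (@lt_le_trans _ _ (mu * sqnorm v)).
  rewrite (qform_diagonalized NQ) (sqnorm_diagonalized QQ') mulr_sumr.
  have [i ci] : exists i, (v *m Q'^T) 0 i != 0.
    apply/existsP; rewrite -negb_forall; apply: contra vn0 => /forallP v0.
    rewrite -sqnorm_eq0 (sqnorm_diagonalized QQ') big1 // => i _.
    by rewrite (eqP (v0 i)) expr0n.
  rewrite [ltLHS](bigD1 i) //= [ltRHS](bigD1 i) //= ltr_leD //.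
    rewrite ltr_pM2r ?exprn_even_gt0 ?ci //; rewrite ltNge; apply/negP => h.
    by rewrite v2 ?eqxx in ci.
  apply: ler_sum => j _; case: (lerP mu (d' 0 j)) => [ge|lt'].
    by rewrite v2 // expr0n !mulr0.
  by rewrite ler_wpM2r ?sqr_ge0 // ltW.
rewrite (qform_diagonalized MQ) (sqnorm_diagonalized QQ) mulr_sumr.
apply: ler_sum => i _; case: (boolP (T i)) => [Ti|nT].
  by rewrite ler_wpM2r ?sqr_ge0 // Pmu.
suff -> : (v *m Q^T) 0 i = 0 by rewrite expr0n !mulr0.
case/submxP: vE => w ->; rewrite /E !mulmxA -mulmxA QQ mulmx1 mxE big1 // => j _.
rewrite !mxE; case: eqP => [e|_]; last by rewrite mulr0.
by move: nT; rewrite e; have := enum_valP j; rewrite -topredE /= => ->.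
Qed.

End CourantFischerCount.

(** * The Perron vector at the boundary *)

Section ExitPath.
Variables (T : finType) (e : rel T) (S : {set T}).

Lemma exit_path_in x p :
  path e x p -> uniq (x :: p) -> x \in S -> last x p \notin S ->
  exists q, [/\ path e x q, uniq (x :: q), {subset q <= p},
    all (mem S) (belast x q) & last x q \notin S].
Proof.
elim: p x => [|y p IHp] x /=; first by move=> _ _ ->.
move=> /andP[exy yp] /andP[xp up] xS lS.
have [yS|yS] := boolP (y \in S); last first.
  exists [:: y]; rewrite /= exy xS yS andbT inE; split=> //.
    by move: xp; rewrite !inE andbT; case/norP.
  by move=> z; rewrite !inE => ->.
have [q [yq uq qp qS lq]] := IHp y yp up yS lS.
exists (y :: q); split=> //=; rewrite ?exy ?xS //.
  rewrite -/(uniq (y :: q)) uq andbT; apply: contra xp.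
  by rewrite !inE => /orP[->//|/qp ->]; rewrite orbT.
by move=> z; rewrite !inE => /orP[->//|/qp ->]; rewrite orbT.
Qed.

(** Cut a simple path at its first vertex outside [S]: the vertices before it are distinct elements
    of [S], which bounds the length. *)
Lemma exit_path x y : connect e x y -> x \in S -> y \notin S ->
  exists p, [/\ path e x p, uniq (x :: p), (size p <= #|S|)%N & last x p \notin S].
Proof.
move=> /connectP[p0 /shortenP[p xp up _]] -> xS yS.
have [q [xq uq _ qS lq]] := exit_path_in xp up xS yS.
exists q; split=> //; rewrite -(size_belast x q) -[size _](card_uniqP _).
  by apply/subset_leq_card/subsetP => z; apply: (allP qS).
by move: uq; rewrite lastI rcons_uniq => /andP[].
Qed.

End ExitPath.

(** The inductive form of Cauchy-Schwarz, from [(m * a - b) ^+ 2 >= 0]. For [m = 0] the hypothesis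
    forces [b = 0]. *)
Lemma sqr_addn_le (R : realFieldType) (m : nat) (a b h s : R) :
  0 <= s -> b ^+ 2 <= m%:R * s -> a ^+ 2 <= h ->
  (a + b) ^+ 2 <= m.+1%:R * (h + s).
Proof.
case: m => [|m] s0 hb ha.
  have -> : b = 0 by apply/eqP; rewrite -sqrf_eq0 eq_le sqr_ge0 andbT; lra.
  by rewrite addr0 mul1r; lra.
rewrite -[m.+2]addn1 natrD; have : 0 < m.+1%:R :> R by rewrite ltr0n.
move: (m.+1%:R) hb => {}m hb m0.
have : 0 <= (m * a - b) ^+ 2 by exact: sqr_ge0.
have : 0 <= (m + 1) * (m * s - b ^+ 2) by rewrite mulr_ge0 ?subr_ge0 //; lra.
have : 0 <= m * (m + 1) * (h - a ^+ 2) by rewrite !mulr_ge0 ?subr_ge0 //; lra.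
move=> h1 h2 h3; rewrite -subr_ge0 -(pmulr_rge0 _ m0).
by move: h1 h2 h3; nra.
Qed.

Section PathEnergy.
Variables (R : realFieldType) (T : finType) (e : rel T) (f : T -> R)
  (g : T -> T -> R).
Hypothesis g_ge0 : forall x y, 0 <= g x y.
Hypothesis e_g : forall x y, e x y -> (f x - f y) ^+ 2 <= g x y.

(** Cauchy-Schwarz along the path. Its vertices are distinct, so each row of [g] is charged at most
    once and the total energy bounds the energy of the path. *)
Lemma path_energy x p : path e x p -> uniq (x :: p) ->
  (f x - f (last x p)) ^+ 2 <= (size p)%:R * \sum_x \sum_y g x y.
Proof.
move=> xp up; have {up}le : \sum_(i <- x :: p) \sum_j g i j <= \sum_i \sum_j g i j.
  rewrite big_uniq //= [leRHS](bigID (mem (x :: p))) /= ler_wpDr //.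
  by apply: sumr_ge0 => i _; apply: sumr_ge0.
apply: le_trans (ler_wpM2l (ler0n _ _) le); move: (x) xp => {le}.
elim: p => [|y p IHp] {}x /=.
  by rewrite subrr expr0n mul0r.
case/andP => exy yp; have {IHp} := IHp y yp.
rewrite [in X in _ -> X](big_cons _ _ x) /=.
have s0 : 0 <= \sum_(i <- y :: p) \sum_j g i j.
  by apply: sumr_ge0 => i _; apply: sumr_ge0.
move: (\sum_(i <- y :: p) _) s0 => s s0 IHp.
have hg : (f x - f y) ^+ 2 <= \sum_j g x j.
  rewrite (le_trans (e_g exy)) // (bigD1 y) //= ler_wpDr //.
  exact: sumr_ge0.
have -> : f x - f (last y p) = (f x - f y) + (f y - f (last y p)).
  by rewrite addrA subrK.
exact: sqr_addn_le.
Qed.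

End PathEnergy.

Section BoundaryEntry.
Variables (R : realFieldType) (n : nat) (G : multigraph n) (Delta : nat).
Hypothesis connG : graph_connected G.
Hypothesis degG : forall i, (degree G i <= Delta)%N.

Lemma sum_emult (i : 'I_n) : \sum_j (emult G i j)%:R = (degree G i)%:R :> R.
Proof. by rewrite -natr_sum. Qed.

(** Expand the square; by symmetry both square terms give the degree-weighted norm. The factor 2
    arises because the sum runs over ordered pairs. *)
Lemma dirichlet_form (f : 'I_n -> R) :
  \sum_i \sum_j (emult G i j)%:R * (f i - f j) ^+ 2 =
  2 * (\sum_i (degree G i)%:R * f i ^+ 2
       - \sum_i f i * \sum_j (emult G i j)%:R * f j).
Proof.
transitivity (\sum_i \sum_j ((emult G i j)%:R * f i ^+ 2
   + (emult G i j)%:R * f j ^+ 2 - 2 * (f i * ((emult G i j)%:R * f j)))).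
  by apply: eq_bigr => i _; apply: eq_bigr => j _; ring.
under eq_bigr do rewrite sumrB big_split /=.
rewrite sumrB big_split /= [X in _ + X - _]exchange_big /=.
have E : \sum_i \sum_j (emult G i j)%:R * f i ^+ 2 =
    \sum_i (degree G i)%:R * f i ^+ 2.
  by apply: eq_bigr => i _; rewrite -mulr_suml sum_emult.
have -> : \sum_j \sum_i (emult G i j)%:R * f j ^+ 2 =
    \sum_i (degree G i)%:R * f i ^+ 2.
  by rewrite -E; apply: eq_bigr => j _; apply: eq_bigr => i _; rewrite emult_sym.
rewrite E; set X := \sum_i _; set Y := \sum_i f i * _.
have -> : \sum_i \sum_j 2 * (f i * ((emult G i j)%:R * f j)) = 2 * Y.
  rewrite /Y mulr_sumr; apply: eq_bigr => i _; rewrite !mulr_sumr.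
  by apply: eq_bigr => j _.
by ring.
Qed.

Lemma boundary_entry (S : {set 'I_n}) t (f : 'I_n -> R) a :
  (#|S| <= t)%N -> S != setT ->
  (forall i, 0 <= f i) -> (forall i, i \notin S -> f i = 0) -> (exists i, f i != 0) ->
  (forall i, i \in S ->
     \sum_j (emult G i j)%:R * f j = a * ((degree G i)%:R * f i)) ->
  a <= 1 /\ exists u v, [/\ u \in S, v \notin S, adjacent G u v &
    \sum_i (degree G i)%:R * f i ^+ 2 <= 16 * Delta%:R ^+ 3 * t%:R ^+ 5 * f u ^+ 2].
Proof.
move=> St /eqP ST f0 fS [i0 fi0] feq.
pose N := \sum_i (degree G i)%:R * f i ^+ 2.
pose x := [arg max_(j > i0) f j]%O.
have fmax j : f j <= f x by rewrite /x; case: arg_maxP => // i1 _ /(_ j isT).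
pose M := f x.
have M0 : 0 < M by apply: lt_le_trans (fmax i0); rewrite lt_def fi0 f0.
have xS : x \in S by apply: contraLR M0 => /fS; rewrite /M => ->; rewrite ltxx.
have [y yS] : exists y, y \notin S.
  apply/existsP; rewrite -negb_forall; apply/negP => /forallP h.
  by apply: ST; apply/setP => z; rewrite inE h.
have D0 : (0 <= Delta%:R :> R) by [].
have t0 : (0 < t)%N by apply: leq_trans St; apply/card_gt0P; exists x.
have t0' : 0 < t%:R :> R by rewrite ltr0n.
have dD i : (degree G i)%:R <= Delta%:R :> R by rewrite ler_nat.
have sumS (h : 'I_n -> R) : (forall i, i \notin S -> h i = 0) ->
    \sum_i h i = \sum_(i in S) h i.
  by move=> h0; rewrite [LHS](bigID (mem S)) /= [X in _ + X]big1 ?addr0.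
have cardS (h : 'I_n -> R) c : 0 <= c -> (forall i, i \in S -> h i <= c) ->
    \sum_(i in S) h i <= c * t%:R.
  move=> c0 hc; apply: (@le_trans _ _ (\sum_(i in S) c)); first exact: ler_sum.
  by rewrite sumr_const -[c *+ _]mulr_natr ler_wpM2l // ler_nat.
have NM : N <= Delta%:R * M ^+ 2 * t%:R.
  rewrite /N sumS => [|i /fS ->]; last by rewrite expr0n mulr0.
  apply: cardS => [|i _]; first by rewrite mulr_ge0 ?sqr_ge0.
  by rewrite ler_pM ?ler0n ?sqr_ge0 // lerXn2r ?nnegrE ?f0 // ltW.
have fAf : \sum_i f i * \sum_j (emult G i j)%:R * f j = a * N.
  rewrite /N mulr_sumr; apply: eq_bigr => i _; have [iS|/fS ->] := boolP (i \in S).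
    by rewrite feq //; ring.
  by rewrite expr0n mul0r !mulr0.
have [p [xp up sp lp]] := exit_path (connG x y) xS yS.
(* The Dirichlet energy of [f] is [2 * ((1 - a) * N)], and [f] drops from [M] to 0 along a path of
   at most [t] edges. *)
have energy : M ^+ 2 <= t%:R * (2 * ((1 - a) * N)).
  have -> : 2 * ((1 - a) * N) =
      \sum_i \sum_j (emult G i j)%:R * (f i - f j) ^+ 2.
    by rewrite dirichlet_form fAf -/N; ring.
  have h0 i j : 0 <= (emult G i j)%:R * (f i - f j) ^+ 2.
    by rewrite mulr_ge0 ?sqr_ge0.
  have := @path_energy R _ (adjacent G) f (fun i j => (emult G i j)%:R * (f i - f j) ^+ 2)
    h0 _ x p xp up.
  rewrite (fS _ lp) subr0 -/M => /(_ _)/le_trans -> //.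
    move=> i j ij; rewrite -[leLHS]mul1r ler_wpM2r ?sqr_ge0 //.
    by rewrite ler1n.
  rewrite ler_wpM2r ?ler_nat ?(leq_trans sp) //.
  by apply: sumr_ge0 => i _; apply: sumr_ge0.
have N0 : 0 <= N by apply: sumr_ge0 => i _; rewrite mulr_ge0 ?sqr_ge0.
have a1 : a < 1.
  rewrite ltNge; apply/negP => ge1.
  have : M ^+ 2 <= 0.
    apply: le_trans energy _.
    by rewrite mulr_ge0_le0 // mulr_ge0_le0 // mulr_le0_ge0 // subr_le0.
  by rewrite leNgt exprn_gt0.
split; first exact: ltW.
pose eS i : R := \sum_(j in ~: S) (emult G i j)%:R.
have eS_le i : eS i <= Delta%:R.
  apply: le_trans (dD i); rewrite -sum_emult [leRHS](bigID (mem (~: S))) /=.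
  by rewrite ler_wpDr // sumr_ge0.
(* Summing the eigenvalue equation over [S], the defect [1 - a] measures exactly the mass sent along
   the edges leaving [S]. *)
have flux : \sum_(i in S) f i * eS i = (1 - a) * \sum_i (degree G i)%:R * f i.
  have E : \sum_(i in S) a * ((degree G i)%:R * f i)
     = \sum_j f j * \sum_(i in S) (emult G j i)%:R.
    rewrite -(eq_bigr _ feq) exchange_big; apply: eq_bigr => j _.
    by rewrite mulr_sumr; apply: eq_bigr => i _; rewrite emult_sym mulrC.
  rewrite mulrBl mul1r mulr_sumr [X in _ - X]sumS => [|i /fS ->]; last by rewrite !mulr0.
  rewrite E -sumrB [RHS]sumS => [|i /fS ->]; last by rewrite mul0r mulr0 subrr.
  apply: eq_bigr => i _; rewrite -sum_emult (bigID (mem S)) /= /eS.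
  rewrite (eq_bigl (fun j => j \notin S)) => [|j]; last by rewrite inE.
  by ring.
(* With this [b], a flux of at most [b * Delta * t] is at most [M / (4 * t)], half of the flux
   [M / (2 * t)] that [energy] requires. *)
pose b := M / (4 * Delta%:R * t%:R ^+ 2).
have D1 : 1 <= Delta%:R :> R.
  rewrite ler1n (leq_trans _ (degG x)) //.
  case: p xp lp {up sp} => [|z p] /=; first by rewrite xS.
  case/andP => xz _ _; apply: leq_trans xz _; rewrite /degree (bigD1 z) //=.
  exact: leq_addr.
have b0 : 0 <= b by rewrite divr_ge0 ?mulr_ge0 ?exprn_ge0 // ltW.
(* A boundary vertex with [f u >= b] exists because otherwise the flux out of
   [S] would be below the value forced by [energy]. *)
have [u /andP[uS /andP[/existsP[v /andP[vS uv]] fub]]] :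
    exists u, (u \in S) && ([exists v, (v \notin S) && adjacent G u v] && (b <= f u)).
  apply/existsP; rewrite -[X in is_true X]negbK negb_exists; apply/negP => /forallP none.
  have : \sum_(i in S) f i * eS i <= b * Delta%:R * t%:R.
    have bD : 0 <= b * Delta%:R by exact: mulr_ge0.
    apply: cardS => [|i iS] //.
    have := none i; rewrite iS /= negb_and; case/orP => [|].
      rewrite negb_exists => /forallP h; rewrite /eS big1 ?mulr0 // => j.
      rewrite inE => jS; have := h j; rewrite jS /= /adjacent -eqn0Ngt => /eqP ->.
      by [].
    by rewrite -ltNge => /ltW lt; rewrite ler_pM // sumr_ge0.
  rewrite flux => h1.
  have h2 : N <= M * \sum_i (degree G i)%:R * f i.
    rewrite mulr_sumr; apply: ler_sum => i _.
    by rewrite expr2 [leRHS]mulrCA ler_wpM2l // ler_wpM2r.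
  have h3 : (1 - a) * N <= M * (b * Delta%:R * t%:R).
    apply: le_trans (ler_wpM2l _ h2) _; first by rewrite subr_ge0 ltW.
    by rewrite mulrCA ler_wpM2l // ltW.
  have h4 : M * (b * Delta%:R * t%:R) = M ^+ 2 / (4 * t%:R).
    by rewrite /b; field; rewrite !gt_eqF //; lra.
  have h5 : M ^+ 2 <= M ^+ 2 / 2.
    apply: le_trans energy _; rewrite mulrCA.
    apply: (@le_trans _ _ (2 * (t%:R * (M ^+ 2 / (4 * t%:R))))).
      by rewrite ler_wpM2l // ler_wpM2l // -h4.
    by rewrite le_eqVlt; apply/orP; left; apply/eqP; field; rewrite gt_eqF.
  by have := exprn_gt0 2 M0; lra.
(* The constant comes from [N <= Delta * M ^+ 2 * t] and [M = 4 * Delta * t ^+ 2 * b]. *)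
exists u, v; split=> //; apply: le_trans NM _.
have -> : Delta%:R * M ^+ 2 * t%:R = 16 * Delta%:R ^+ 3 * t%:R ^+ 5 * b ^+ 2.
  by rewrite /b; field; rewrite !gt_eqF //; lra.
rewrite ler_wpM2l ?mulr_ge0 ?exprn_ge0 //.
by rewrite lerXn2r ?nnegrE.
Qed.

End BoundaryEntry.

(** * Principal submatrices and their growth *)

Section PrincipalSubmatrices.
Variables (R : realType) (n : nat).
Implicit Types (M : 'M[R]_n) (S T : {set 'I_n}) (v w : 'rV[R]_n).

(* The principal submatrix on [S], kept at full size by zero padding. *)
Definition mask_mx S M : 'M[R]_n :=
  \matrix_(i, j) (if (i \in S) && (j \in S) then M i j else 0).

Definition supported S v : Prop := forall i, i \notin S -> v 0 i = 0.

Definition qform_le M S mu : Prop :=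
  forall v, supported S v -> qform M v <= mu * sqnorm v.

Lemma mask_mx_sym S M : M^T = M -> (mask_mx S M)^T = mask_mx S M.
Proof.
move=> symM; apply/matrixP => i j; rewrite !mxE andbC; case: ifP => // _.
by rewrite -[in LHS]symM mxE.
Qed.

Lemma qform_mask S M v : supported S v -> qform (mask_mx S M) v = qform M v.
Proof.
move=> vS; rewrite !qformE; apply: eq_bigr => i _; apply: eq_bigr => j _.
rewrite mxE; have [iS|/vS ->] := boolP (i \in S); last by rewrite !mulr0 !mul0r.
by have [jS|/vS ->] := boolP (j \in S); last by rewrite !mulr0.
Qed.

Lemma qform_mask_restrict S M v :
  exists w, [/\ supported S w, qform (mask_mx S M) v = qform M w & sqnorm w <= sqnorm v].
Proof.
pose w := \row_i (if i \in S then v 0 i else 0).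
have wS : supported S w by move=> i iS; rewrite mxE (negbTE iS).
exists w; split=> //.
  rewrite -(qform_mask M wS) !qformE; apply: eq_bigr => i _; apply: eq_bigr => j _.
  by rewrite !mxE; case: ifP => [/andP[-> ->]//|_]; rewrite !mul0r.
rewrite !sqnormE; apply: ler_sum => i _; rewrite mxE; case: ifP => // _.
by rewrite expr0n sqr_ge0.
Qed.

Lemma qform_le_mask S M mu : 0 <= mu -> qform_le M S mu ->
  forall v, qform (mask_mx S M) v <= mu * sqnorm v.
Proof.
move=> mu0 le v; have [w [wS -> ws]] := qform_mask_restrict S M v.
exact: le_trans (le w wS) (ler_wpM2l mu0 ws).
Qed.

Lemma mask_mx_ge0 S M i j : (forall i j, 0 <= M i j) -> 0 <= mask_mx S M i j.
Proof. by move=> M0; rewrite mxE; case: ifP. Qed.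

Definition abs_row v : 'rV[R]_n := \row_i `|v 0 i|.

Lemma sqnorm_abs v : sqnorm (abs_row v) = sqnorm v.
Proof. by rewrite !sqnormE; apply: eq_bigr => i _; rewrite mxE real_normK ?num_real. Qed.

Lemma qform_abs M v : (forall i j, 0 <= M i j) -> `|qform M v| <= qform M (abs_row v).
Proof.
move=> M0; rewrite !qformE; apply: le_trans (ler_norm_sum _ _ _) _.
apply: ler_sum => i _; apply: le_trans (ler_norm_sum _ _ _) _.
by apply: ler_sum => j _; rewrite !mxE !normrM ger0_norm.
Qed.

(* Nonnegativity of the entries makes the spectral radius equal to the top
   eigenvalue, so that a one-sided bound on the form suffices. *)
Lemma mask_expmx_diag_le S M mu k x :
  M^T = M -> (forall i j, 0 <= M i j) -> 0 <= mu -> qform_le M S mu ->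
  (mask_mx S M ^+ k.*2) x x <= mu ^+ k.*2.
Proof.
move=> symM M0 mu0 le.
have [Q [d [QQ MQ]]] := symmetric_diagonalization (mask_mx_sym S symM).
rewrite (expmx_diagonalized_diag QQ MQ).
have QtQ : \sum_i Q i x ^+ 2 = 1.
  have /matrixP/(_ x x) := mulmx1C QQ; rewrite !mxE eqxx mulr1n => <-.
  by apply: eq_bigr => i _; rewrite mxE expr2.
rewrite -[leRHS]mulr1 -QtQ mulr_sumr; apply: ler_sum => i _.
rewrite ler_wpM2r ?sqr_ge0 // -!muln2 !(mulnC k) !exprM.
have : `|d 0 i| <= mu.
  have rQ : row i Q *m Q^T = delta_mx 0 i by rewrite -row_mul QQ row1.
  have q1 : sqnorm (row i Q) = 1.
    rewrite (sqnorm_diagonalized QQ) rQ (bigD1 i) //= big1 => [|j ne].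
      by rewrite mxE !eqxx expr1n addr0.
    by rewrite mxE (negbTE ne) expr0n.
  have qd : qform (mask_mx S M) (row i Q) = d 0 i.
    rewrite (qform_diagonalized MQ) rQ (bigD1 i) //= big1 => [|j ne].
      by rewrite mxE !eqxx expr1n addr0 mulr1.
    by rewrite mxE (negbTE ne) expr0n mulr0.
  have B0 i1 j1 : 0 <= mask_mx S M i1 j1 by exact: mask_mx_ge0.
  rewrite -qd; apply: le_trans (qform_abs _ B0) _.
  by apply: le_trans (qform_le_mask mu0 le _) _; rewrite sqnorm_abs q1 mulr1.
move=> h; rewrite lerXn2r ?nnegrE ?sqr_ge0 // -real_normK ?num_real //.
by rewrite lerXn2r ?nnegrE.
Qed.

(** Replacing the entries of a top eigenvector by their absolute values does not lower the form, so
    the result still attains the maximum and is an eigenvector. Rows of the masked matrix outside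
    [S] vanish, so an eigenvector is supported on [S] once its eigenvalue is nonzero; hence the
    condition [0 < a]. *)
Lemma perron_vector S M : M^T = M -> (forall i j, 0 <= M i j) -> (0 < n)%N ->
  exists a : R, qform_le M S a /\ (0 < a -> exists w,
    [/\ w != 0, supported S w, forall i, 0 <= w 0 i &
        forall i, i \in S -> \sum_j M i j * w 0 j = a * w 0 i]).
Proof.
move=> symM M0 n0; have symB := mask_mx_sym S symM.
have [a [v [vn0 vB le]]] := top_eigenvector symB n0.
exists a; split=> [w wS|a0]; first by rewrite -(qform_mask M wS).
pose w := abs_row v.
have wn0 : w != 0 by rewrite -sqnorm_eq0 sqnorm_abs sqnorm_eq0.
have wB : w *m mask_mx S M = a *: w.
  apply: qform_max_eigenvector => //.
  rewrite sqnorm_abs -[leLHS](_ : qform (mask_mx S M) v = _); last first.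
    by rewrite /qform vB -scalemxAl mxE.
  have B0 i1 j1 : 0 <= mask_mx S M i1 j1 by exact: mask_mx_ge0.
  exact: le_trans (ler_norm _) (qform_abs _ B0).
have wj i : \sum_j w 0 j * mask_mx S M j i = a * w 0 i.
  by have /rowP/(_ i) := wB; rewrite !mxE.
have wS : supported S w.
  move=> i iS; have /eqP := wj i; rewrite big1 => [|j _]; last first.
    by rewrite [X in _ * X]mxE (negbTE iS) andbF mulr0.
  by rewrite eq_sym mulf_eq0 gt_eqF // => /eqP.
exists w; split=> // [i|i iS]; first by rewrite mxE.
rewrite -wj; apply: eq_bigr => j _; rewrite [X in _ = _ * X]mxE iS andbT.
have [jS|/wS ->] := boolP (j \in S); last by rewrite mulr0 mul0r.
by rewrite -[in LHS]symM [X in X * _]mxE mulrC.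
Qed.

End PrincipalSubmatrices.

(** * Enlarging a vertex set by one neighbour *)

Section NormalizedAdjacency.
Variables (R : realType) (n : nat) (G : multigraph n).
Hypothesis deg_gt0 : forall i, (0 < degree G i)%N.

Local Notation N := (normalized_adjacency_mx R G).
Local Notation r i := ((Num.sqrt (degree G i)%:R)^-1 : R).

Lemma normalized_adjacencyE i j : N i j = (emult G i j)%:R * r i * r j.
Proof.
rewrite /normalized_adjacency_mx mul_mx_diag mxE; congr (_ * _).
  by rewrite mul_diag_mx !mxE mulrC.
by rewrite mxE.
Qed.

Lemma normalized_adjacency_sym : N^T = N.
Proof.
apply/matrixP => i j; rewrite mxE !normalized_adjacencyE emult_sym.
by rewrite -!mulrA [r j * _]mulrC.
Qed.

Lemma normalized_adjacency_ge0 i j : 0 <= N i j.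
Proof. by rewrite normalized_adjacencyE !mulr_ge0 ?invr_ge0 ?sqrtr_ge0. Qed.

Let r_gt0 i : 0 < r i. Proof. by rewrite invr_gt0 sqrtr_gt0 ltr0n. Qed.

Let dr2 i : (degree G i)%:R * r i ^+ 2 = 1 :> R.
Proof. by rewrite exprVn sqr_sqrtr ?ler0n // divff // pnatr_eq0 -lt0n. Qed.

Lemma qform_normalized (v : 'rV[R]_n) :
  qform N v = \sum_i (r i * v 0 i) * \sum_j (emult G i j)%:R * (r j * v 0 j).
Proof.
rewrite qformE; apply: eq_bigr => i _; rewrite mulr_sumr; apply: eq_bigr => j _.
by rewrite normalized_adjacencyE; ring.
Qed.

Lemma sqnorm_normalized (v : 'rV[R]_n) :
  sqnorm v = \sum_i (degree G i)%:R * (r i * v 0 i) ^+ 2.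
Proof. by rewrite sqnormE; apply: eq_bigr => i _; rewrite exprMn mulrA dr2 mul1r. Qed.

Variable Delta : nat.
Hypothesis connG : graph_connected G.
Hypothesis degG : forall i, (degree G i <= Delta)%N.

(* Half of the lower bound that [boundary_entry] gives for the quantity [y] in
   the proof of [qform_le_extend]. *)
Definition gain (t : nat) : R := (32 * Delta%:R ^+ 4 * t%:R ^+ 5)^-1.

(** The Perron vector of [S] is extended to the outer neighbour [v] supplied by [boundary_entry]. A
    small value at [v] raises the form to first order but the norm only to second order; optimizing
    it yields [a * (1 + 2 * y) <= mu * (1 + y)], where the large entry next to [v] bounds [y] from
    below. *)
Lemma qform_le_extend (S : {set 'I_n}) t (mu : R) :
  (#|S| <= t)%N -> S != setT -> 0 <= mu ->
  (forall u v, u \in S -> v \notin S -> adjacent G u v -> qform_le N (v |: S) mu) ->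
  qform_le N S (mu / (1 + gain t)).
Proof.
move=> St ST mu0 ext.
have gain0 : 0 <= gain t by rewrite invr_ge0 !mulr_ge0 ?exprn_ge0.
have n0 : (0 < n)%N.
  by case: n G S ST {St ext} => // G' S /eqP[]; apply/setP => -[].
have [a [aS pv]] := perron_vector S normalized_adjacency_sym normalized_adjacency_ge0 n0.
suff le : a <= mu / (1 + gain t).
  by move=> v vS; rewrite (le_trans (aS v vS)) // ler_wpM2r ?sqnorm_ge0.
case: (lerP a 0) => [a0|a0].
  by rewrite (le_trans a0) // divr_ge0 // addr_ge0.
have {pv}[w [wn0 wS w0 weq]] := pv a0.
(* This rescaling turns the eigenvalue equation of [N] into the degree-weighted equation that
   [boundary_entry] expects. *)
pose f i := r i * w 0 i.
have fS i : i \notin S -> f i = 0 by move=> /wS h; rewrite /f h mulr0.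
have f0 i : 0 <= f i by rewrite /f mulr_ge0 // ltW.
have feq i : i \in S ->
    \sum_j (emult G i j)%:R * f j = a * ((degree G i)%:R * f i).
  move=> iS; apply: (mulfI (lt0r_neq0 (r_gt0 i))).
  transitivity (\sum_j N i j * w 0 j).
    rewrite mulr_sumr; apply: eq_bigr => j _.
    by rewrite normalized_adjacencyE /f; ring.
  rewrite weq //; transitivity (a * ((degree G i)%:R * r i ^+ 2 * w 0 i)).
    by rewrite dr2 mul1r.
  by rewrite /f; ring.
have fn0 : exists i, f i != 0.
  apply/existsP; rewrite -negb_forall; apply: contra wn0 => /forallP h.
  apply/eqP/rowP => i; rewrite mxE; have /eqP/eqP := h i; rewrite mulf_eq0.
  by rewrite gt_eqF ?r_gt0 //= => /eqP.
have [a1 [u [v [uS vS uv hu]]]] := boundary_entry connG degG St ST f0 fS fn0 feq.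
pose K := \sum_i (degree G i)%:R * f i ^+ 2.
have K0 : 0 < K.
  by rewrite /K -(sqnorm_normalized w) sqnorm_gt0.
pose b := \sum_j (emult G v j)%:R * f j.
have ub : f u <= b.
  rewrite /b (bigD1 u) //= -[leLHS]addr0 lerD ?sumr_ge0 //; last first.
    by move=> i _; rewrite mulr_ge0.
  by rewrite -[leLHS]mul1r ler_wpM2r // ler1n emult_sym.
(* The test vector is [f] plus [s] times the indicator of [v]; the best [s] is
   [b / (d a)]. *)
have key s : a * K + 2 * s * b <= mu * (K + s ^+ 2 * (degree G v)%:R).
  pose g i := f i + s * (i == v)%:R.
  pose w' : 'rV[R]_n := \row_i (g i / r i).
  have rw' i : r i * w' 0 i = g i.
    by rewrite mxE mulrC divfK // gt_eqF ?r_gt0.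
  have w'S : supported (v |: S) w'.
    move=> i; rewrite in_setU1 negb_or => /andP[iv iS].
    by rewrite mxE /g fS // (negbTE iv) mulr0 addr0 mul0r.
  have := ext u v uS vS uv w' w'S; rewrite qform_normalized sqnorm_normalized.
  have -> : \sum_i (degree G i)%:R * (r i * w' 0 i) ^+ 2 = K + s ^+ 2 * (degree G v)%:R.
    under eq_bigr do rewrite rw'.
    rewrite /K (bigD1 v) //= [in RHS](bigD1 v) //= {1}/g eqxx fS //.
    rewrite (eq_bigr (fun i => (degree G i)%:R * f i ^+ 2)) => [|i iv].
      by rewrite mulr1; ring.
    by rewrite /g (negbTE iv) mulr0 addr0.
  have gsum i : \sum_j (emult G i j)%:R * g j =
      \sum_j (emult G i j)%:R * f j + s * (emult G i v)%:R.
    rewrite /g; under eq_bigr do rewrite mulrDr.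
    rewrite big_split /=; congr (_ + _); rewrite (bigD1 v) //= big1 => [|j jv].
      by rewrite eqxx mulr1; ring.
    by rewrite (negbTE jv) !mulr0.
  have -> : \sum_i r i * w' 0 i * (\sum_j (emult G i j)%:R * (r j * w' 0 j)) =
      a * K + 2 * s * b + s ^+ 2 * (emult G v v)%:R.
    under eq_bigr => i _ do (under eq_bigr do rewrite rw'; rewrite rw' gsum).
    rewrite (eq_bigr (fun i => f i * (\sum_j (emult G i j)%:R * f j)
        + s * (f i * (emult G i v)%:R) + (i == v)%:R * (s * (\sum_j (emult G i j)%:R * f j)
            + s ^+ 2 * (emult G i v)%:R))) => [|i _]; last first.
      by rewrite /g; ring.
    rewrite !big_split /= -mulr_sumr.
    have -> : \sum_i f i * (\sum_j (emult G i j)%:R * f j) = a * K.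
      rewrite /K mulr_sumr; apply: eq_bigr => i _; have [iS|/fS ->] := boolP (i \in S).
        by rewrite feq //; ring.
      by rewrite expr0n mul0r !mulr0.
    have -> : \sum_i f i * (emult G i v)%:R = b.
      by apply: eq_bigr => i _; rewrite emult_sym mulrC.
    rewrite [X in _ + X](bigD1 v) //= [X in _ + (_ + X)]big1 => [|i iv]; last first.
      by rewrite (negbTE iv) mul0r.
    by rewrite eqxx mul1r -/b; ring.
  (* A self-loop at [v] only adds the nonnegative term [s ^+ 2 * emult G v v] to the form, which is
     dropped. *)
  by apply: le_trans; rewrite lerDl mulr_ge0 ?sqr_ge0.
pose d := (degree G v)%:R : R.
have d0 : 0 < d by rewrite ltr0n.
have D0 : 0 < Delta%:R :> R by rewrite ltr0n (leq_trans (deg_gt0 v)).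
have t0 : 0 < t%:R :> R.
  by rewrite ltr0n (leq_trans _ St) //; apply/card_gt0P; exists u.
pose y := b ^+ 2 / (d * a ^+ 2 * K).
have {}key : a * (1 + 2 * y) <= mu * (1 + y).
  rewrite -(ler_pM2r K0); have := key (b / (d * a)); rewrite -/d.
  have -> : a * K + 2 * (b / (d * a)) * b = a * (1 + 2 * y) * K.
    by rewrite /y; field; rewrite !gt_eqF.
  have -> // : mu * (K + (b / (d * a)) ^+ 2 * d) = mu * (1 + y) * K.
  by rewrite /y; field; rewrite !gt_eqF.
have gy : 2 * gain t <= y.
  have P0 : 0 < 16 * Delta%:R ^+ 4 * t%:R ^+ 5 :> R by rewrite !mulr_gt0 ?exprn_gt0.
  have -> : 2 * gain t = (16 * Delta%:R ^+ 4 * t%:R ^+ 5)^-1.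
    by rewrite /gain; field; rewrite !gt_eqF.
  rewrite /y ler_pdivlMr ?mulr_gt0 ?exprn_gt0 // mulrC ler_pdivrMr //.
  apply: (@le_trans _ _ (Delta%:R * (16 * Delta%:R ^+ 3 * t%:R ^+ 5 * f u ^+ 2))).
    have a2 : a ^+ 2 <= 1 by rewrite expr_le1 // ltW.
    have da : d * a ^+ 2 <= Delta%:R.
      rewrite -[leRHS]mulr1; apply: ler_pM => //; rewrite ?sqr_ge0 ?(ltW d0) //.
      by rewrite /d ler_nat.
    by apply: (ler_pM _ (ltW K0) da hu); rewrite mulr_ge0 ?sqr_ge0 ?(ltW d0).
  have -> : b ^+ 2 * (16 * Delta%:R ^+ 4 * t%:R ^+ 5) =
    Delta%:R * (16 * Delta%:R ^+ 3 * t%:R ^+ 5 * b ^+ 2) by ring.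
  rewrite !ler_wpM2l ?mulr_ge0 ?exprn_ge0 ?(ltW D0) ?(ltW t0) //.
  by rewrite lerXn2r ?nnegrE ?(le_trans _ ub).
have g1 : gain t <= 2^-1.
  rewrite /gain lef_pV2 ?posrE ?mulr_gt0 ?exprn_gt0 //.
  have : 1 <= Delta%:R ^+ 4 :> R by rewrite exprn_ege1 // ler1n -(ltr0n R).
  have : 1 <= t%:R ^+ 5 :> R by rewrite exprn_ege1 // ler1n -(ltr0n R).
  move=> h1 h2; have := mulr_ege1 h2 h1; rewrite -mulrA.
  by move: (Delta%:R ^+ 4 * _) => p; lra.
rewrite ler_pdivlMr; last by rewrite ltr_wpDr.
have y0 : 0 <= y by lra.
rewrite -(ler_pM2r (_ : 0 < 1 + y)); last by rewrite ltr_wpDr.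
(* It remains to see [(1 + gain t) * (1 + y) <= 1 + 2 * y], which follows from [gain t <= y / 2] and
   [gain t <= 1 / 2]. *)
apply: le_trans key; rewrite -mulrA ler_wpM2l ?(ltW a0) //.
have : gain t * y <= 2^-1 * y by rewrite ler_wpM2r.
by move: gy y0; lra.
Qed.

(* Each of the [m] steps enlarges the ball radius and the set by one. *)
Lemma qform_le_iter (B : nat -> {set 'I_n}) (S : {set 'I_n}) t m j (mu : R) :
  (forall i u v, u \in B i -> adjacent G u v -> v \in B i.+1) ->
  (forall i, B i \subset B i.+1) ->
  (#|S| + m <= t)%N -> (t < n)%N -> S \subset B j -> 0 <= mu ->
  qform_le N (B (j + m)%N) mu ->
  qform_le N S (mu / (1 + gain t) ^+ m).
Proof.
move=> Badj Bsub; elim: m S j => [|m IHm] S j St tn SB mu0 le.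
  rewrite addn0 in le; rewrite expr0 divr1 => v vS; apply: le => i iB.
  by apply: vS; apply: contra iB; apply: (subsetP SB).
have gain0 : 0 <= gain t by rewrite invr_ge0 !mulr_ge0 ?exprn_ge0.
have St' : (#|S| <= t)%N by apply: leq_trans St; apply: leq_addr.
rewrite exprSr invfM mulrA; apply: qform_le_extend => //.
- apply: contraTneq tn => ST; rewrite -leqNgt (leq_trans _ St') //.
  by rewrite ST cardsT card_ord.
- by rewrite divr_ge0 // exprn_ge0 // addr_ge0.
move=> u v uS vS uv; apply: (IHm _ j.+1) => //.
- by rewrite cardsU1 vS add1n addSnnS.
- rewrite subUset sub1set (Badj _ u) ?(subsetP SB) //=.
  exact: subset_trans SB (Bsub j).
- by rewrite addSnnS.
Qed.

End NormalizedAdjacency.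

(** * Walks and neighbourhoods *)

Section Walks.
Variables (R : realType) (n : nat).
Implicit Types (M : 'M[R]_n) (S : {set 'I_n}) (x : 'I_n) (p : seq 'I_n).

Fixpoint walk_weight M x p : R :=
  if p is y :: q then M x y * walk_weight M y q else 1.

(** All vertex sequences are listed, whether or not they follow edges: those using a non-edge get
    weight 0 from the adjacency matrix. The starting vertex is not part of the sequence. *)
Fixpoint walks k : seq (seq 'I_n) :=
  if k is k'.+1 then [seq y :: q | y <- enum 'I_n, q <- walks k'] else [:: [::]].

Lemma walksS k :
  walks k.+1 = [seq y :: q | y <- enum 'I_n, q <- walks k].
Proof. by []. Qed.

Lemma size_walks k p : p \in walks k -> size p = k.
Proof.
elim: k p => [|k IHk] p /=; first by rewrite inE => /eqP ->.
by case/allpairsP => -[y q] /= [_ /IHk <- ->].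
Qed.

Lemma expmx_walks M k x z :
  (M ^+ k) x z = \sum_(p <- walks k | last x p == z) walk_weight M x p.
Proof.
elim: k x => [|k IHk] x.
  by rewrite expr0 /= big_mkcond big_seq1 /= mxE; case: eqP.
rewrite exprS -mulmxE mxE walksS [RHS]big_mkcond big_allpairs_dep big_enum /=.
apply: eq_bigr => y _; rewrite IHk big_mkcond /= mulr_sumr.
by apply: eq_bigr => q _; case: ifP; rewrite ?mulr0.
Qed.

Definition walk_support x p : {set 'I_n} := [set z in x :: p].

Lemma walk_supportE x p S : (walk_support x p \subset S) = all (mem S) (x :: p).
Proof.
apply/subsetP/allP => h z; first by move=> zp; apply: h; rewrite inE.
by rewrite inE => /h.
Qed.

Lemma walk_weight_ge0 M x p : (forall i j, 0 <= M i j) -> 0 <= walk_weight M x p.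
Proof.
by move=> M0; elim: p x => [|y p IHp] x //=; rewrite mulr_ge0.
Qed.

(** The empty walk is excluded because its weight is 1 even when [x] lies outside [S]. *)
Lemma walk_weight_mask S M x p : (0 < size p)%N ->
  walk_weight (mask_mx S M) x p =
  if walk_support x p \subset S then walk_weight M x p else 0.
Proof.
rewrite walk_supportE; elim: p x => [//|y [|z p] IHp] x _ /=.
  by rewrite !mxE andbT mulr1; case: ifP; rewrite ?mulr1.
have /= -> := IHp y isT; rewrite mxE.
case: (x \in S); rewrite /= ?mul0r //.
by case: (y \in S); rewrite /= ?mul0r ?mulr0 //; case: ifP; rewrite ?mulr0.
Qed.

End Walks.

(** * Balls, and connected sets grown vertex by vertex *)

Section Neighbourhoods.
Variables (n : nat) (G : multigraph n) (Delta : nat).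
Hypothesis degG : forall i, (degree G i <= Delta)%N.

Definition neighbours (T : {set 'I_n}) : {set 'I_n} :=
  [set v | [exists u in T, adjacent G u v]].

Lemma neighboursP (T : {set 'I_n}) v :
  reflect (exists2 u, u \in T & adjacent G u v) (v \in neighbours T).
Proof. by rewrite inE; apply: exists_inP. Qed.

Lemma adjacent_sym u v : adjacent G u v = adjacent G v u.
Proof. by rewrite /adjacent emult_sym. Qed.

Lemma card_neighbours T : (#|neighbours T| <= #|T| * Delta)%N.
Proof.
apply: (@leq_trans (\sum_(u in T) degree G u)); last first.
  by rewrite -sum_nat_const leq_sum.
rewrite /degree exchange_big -sum1_card big_mkcond leq_sum // => v _.
case: ifP => // /neighboursP[u uT uv]; rewrite (bigD1 u) //=.
exact: leq_trans uv (leq_addr _ _).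
Qed.

Fixpoint ball x i : {set 'I_n} :=
  if i is i'.+1 then ball x i' :|: neighbours (ball x i') else [set x].

Lemma ball_sub x i : ball x i \subset ball x i.+1.
Proof. exact: subsetUl. Qed.

Lemma ball_adj x i u v : u \in ball x i -> adjacent G u v -> v \in ball x i.+1.
Proof.
by move=> uB uv; rewrite /= in_setU; apply/orP; right; apply/neighboursP; exists u.
Qed.

Lemma ball_leq x i j : (i <= j)%N -> ball x i \subset ball x j.
Proof.
move=> /subnKC <-; elim: (j - i)%N => [|m IHm]; first by rewrite addn0.
by rewrite addnS; apply: subset_trans IHm (ball_sub _ _).
Qed.

Lemma ball_center x i : x \in ball x i.
Proof. by apply: (subsetP (ball_leq x (leq0n i))); rewrite inE. Qed.

Lemma ball_trans x y z i j : y \in ball x i -> z \in ball y j -> z \in ball x (i + j).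
Proof.
move=> yx; elim: j z => [|j IHj] z /=; first by rewrite inE addn0 => /eqP ->.
rewrite in_setU addnS => /orP[/IHj|/neighboursP[u /IHj uB uz]].
  exact: (subsetP (ball_sub _ _)).
exact: ball_adj uB uz.
Qed.

Lemma ball_sym x y i : y \in ball x i -> x \in ball y i.
Proof.
elim: i y => [|i IHi] y /=; first by rewrite !inE eq_sym.
rewrite -/(ball y i.+1) in_setU => /orP[/IHi|/neighboursP[u /IHi ux uy]].
  exact: (subsetP (ball_sub _ _)).
have uB : u \in ball y 1.
  by apply: (@ball_adj y 0 y); rewrite ?inE // adjacent_sym.
by have := ball_trans uB ux; rewrite add1n.
Qed.

Lemma card_ball x i : (#|ball x i| <= Delta.+1 ^ i)%N.
Proof.
elim: i => [|i IHi]; first by rewrite /= cards1.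
apply: leq_trans (leq_card_setU _ _) _.
apply: (@leq_trans (#|ball x i| * Delta.+1)%N).
  by rewrite mulnS leq_add2l card_neighbours.
by rewrite expnSr leq_mul2r IHi orbT.
Qed.

Lemma path_ball x p : path (adjacent G) x p -> {subset x :: p <= ball x (size p)}.
Proof.
elim/last_ind: p => [|p y IHp]; first by move=> _ z; rewrite !inE.
rewrite rcons_path size_rcons => /andP[/IHp {}IHp ly] z.
rewrite -rcons_cons mem_rcons inE => /orP[/eqP ->|/IHp].
  by apply: ball_adj ly; apply: IHp; apply: mem_last.
exact: (subsetP (ball_sub _ _)).
Qed.

(* These include the supports of all walks from [x] visiting at most [m + 1]
   vertices. *)
Fixpoint grown_sets x m : seq {set 'I_n} :=
  if m is m'.+1 then
    grown_sets x m' ++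
    [seq v |: T | T <- grown_sets x m', v <- enum (neighbours T)]
  else [:: [set x]].

Lemma grown_setsP x m T : T \in grown_sets x m ->
  (#|T| <= m.+1)%N /\ T \subset ball x m.
Proof.
elim: m T => [|m IHm] T /=; first by rewrite inE => /eqP ->; rewrite cards1.
rewrite mem_cat => /orP[/IHm[cT sT]|].
  by split; [apply: leq_trans cT _|apply: subset_trans sT (ball_sub _ _)].
case/allpairsPdep => T' [v [/IHm[cT sT]]]; rewrite mem_enum => vT ->; split.
  by rewrite cardsU1 -[X in (_ <= X)%N]add1n leq_add // leq_b1.
rewrite subUset sub1set -/(ball x m.+1) (subset_trans sT (ball_sub _ _)) andbT.
by case/neighboursP: vT => u /(subsetP sT) uB uv; apply: ball_adj uB uv.
Qed.

(** Before each round the sets have at most [s] vertices, hence at most [s * Delta] neighbours, so a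
    round multiplies the count by at most [s * Delta + 1]. *)
Lemma size_grown_sets x m s : (m <= s)%N ->
  (size (grown_sets x m) <= (s * Delta).+1 ^ m)%N.
Proof.
elim: m => [//|m IHm] ms /=; rewrite size_cat size_allpairs_dep expnSr.
have {}IHm := IHm (ltnW ms).
have le : all (fun T : {set 'I_n} => #|T| <= m.+1)%N (grown_sets x m).
  by apply/allP => T /grown_setsP[].
apply: (@leq_trans (size (grown_sets x m) * (s * Delta).+1)%N); last first.
  by rewrite leq_mul2r IHm orbT.
rewrite mulnS leq_add2l; elim: (grown_sets x m) le => [//|T F IHF] /= /andP[cT /IHF le].
rewrite mulSn leq_add // -cardE (leq_trans (card_neighbours _)) // leq_mul2r.
by rewrite (leq_trans cT) ?orbT.
Qed.

Lemma grown_sets_leq x i j : (i <= j)%N -> {subset grown_sets x i <= grown_sets x j}.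
Proof.
move=> /subnKC <-; elim: (j - i)%N => [|m IHm] T; first by rewrite addn0.
by move/IHm; rewrite addnS /= mem_cat => ->.
Qed.

(** The walk dictates the order of growth: a vertex visited for the first time is adjacent to the
    part already visited. *)
Lemma walk_support_grown x p : path (adjacent G) x p ->
  walk_support x p \in grown_sets x #|walk_support x p|.-1.
Proof.
elim/last_ind: p => [|p y IHp] xp.
  have -> : walk_support x [::] = [set x] by apply/setP => z; rewrite !inE.
  by rewrite cards1 inE.
move: xp; rewrite rcons_path => /andP[/IHp {}IHp ly].
have E : walk_support x (rcons p y) = y |: walk_support x p.
  by apply/setP => z; rewrite !inE mem_rcons inE orbCA.
have [yS|yS] := boolP (y \in walk_support x p).
  suff -> : walk_support x (rcons p y) = walk_support x p by [].
  by rewrite E; apply/setUidPr; rewrite sub1set.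
rewrite E cardsU1 yS add1n /=.
have : (0 < #|walk_support x p|)%N.
  by apply/card_gt0P; exists x; rewrite !inE eqxx.
move: IHp; case: #|_| => // m /= IHp _; rewrite mem_cat; apply/orP; right.
apply/allpairsPdep; exists (walk_support x p), y; split=> //.
rewrite mem_enum; apply/neighboursP; exists (last x p) => //.
by rewrite inE mem_last.
Qed.

End Neighbourhoods.

(** * The second eigenvalue *)

Lemma count_gt_second (R : realType) n (M : 'M[R]_n) :
  (count (> nth 0 (spectrum M) 1%N)%R (spectrum M) <= 1)%N.
Proof.
have : sorted >=%R (spectrum M) by apply: sort_sorted => x y; apply: le_total.
case: (spectrum M) => [//|a [|b s]] /=; first by rewrite addn0 leq_b1.
case/andP => _ bs; rewrite ltxx add0n; suff -> : count (> b)%R s = 0%N.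
  by rewrite addn0 leq_b1.
apply/eqP; rewrite -leqn0 leqNgt -has_count; apply/hasPn => x xs.
rewrite -leNgt; move: bs; rewrite path_sortedE; last first.
  by move=> ? ? ? h1 h2; apply: le_trans h2 h1.
by case/andP => /allP/(_ x xs).
Qed.

Section SecondEigenvalue.
Variables (R : realType) (n : nat) (G : multigraph n) (Delta : nat).
Hypothesis connG : graph_connected G.
Hypothesis degG : forall i, (degree G i <= Delta)%N.
Hypothesis deg_gt0 : forall i, (0 < degree G i)%N.

Local Notation N := (normalized_adjacency_mx R G).
Local Notation lambda2 := (lambda R G 2).
Let N_ge0 := normalized_adjacency_ge0 R G.
Let N_sym := normalized_adjacency_sym R G.

Lemma qform_le_sub (M : 'M[R]_n) (S T : {set 'I_n}) (mu : R) :
  S \subset T -> qform_le M T mu -> qform_le M S mu.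
Proof.
by move=> /subsetP ST le v vS; apply: le => i iT; apply: vS; apply: contra iT => /ST.
Qed.

Lemma qform_addZ (M : 'M[R]_n) (a b : R) (v w : 'rV_n) : M^T = M ->
  qform M (a *: v + b *: w) =
  a ^+ 2 * qform M v + 2 * a * b * (v *m M *m w^T) 0 0 + b ^+ 2 * qform M w.
Proof.
move=> symM; rewrite /qform linearD /= !linearZ /= !mulmxDl !mulmxDr.
rewrite -!scalemxAl -!scalemxAr.
have -> : w *m M *m v^T = (v *m M *m w^T)^T.
  by rewrite !trmx_mul trmxK symM mulmxA.
by rewrite !mxE; ring.
Qed.

(* Otherwise the two balls carry a plane on which the form exceeds [lambda2]. *)
Lemma large_balls_close x y i :
  ~ qform_le N (ball G x i) lambda2 -> ~ qform_le N (ball G y i) lambda2 ->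
  y \in ball G x (i + i).+1.
Proof.
move=> /existsNP[v /not_implyP[vS /negP]]; rewrite -ltNge => vgt.
move=> /existsNP[w /not_implyP[wS /negP]]; rewrite -ltNge => wgt.
apply: contraT => yx.
have far u z : u \in ball G x i -> z \in ball G y i -> u != z /\ ~~ adjacent G u z.
  move=> ux zy; have yz := ball_sym zy; split; apply: contra yx.
    move=> /eqP uz; apply: (subsetP (ball_sub _ _ _)).
    by apply: ball_trans ux _; rewrite uz.
  by move=> uz; rewrite -addSn; apply: ball_trans (ball_adj ux uz) yz.
have vMw : (v *m N *m w^T) 0 0 = 0.
  rewrite mxE big1 // => z _; rewrite !mxE mulr_suml big1 // => u _.
  have [ux|/vS ->] := boolP (u \in ball G x i); last by rewrite !mul0r.
  have [zy|/wS ->] := boolP (z \in ball G y i); last by rewrite mulr0.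
  have [_] := far u z ux zy; rewrite normalized_adjacencyE /adjacent -eqn0Ngt.
  by move=> /eqP ->; rewrite !mul0r mulr0 mul0r.
have vw : (v *m w^T) 0 0 = 0.
  rewrite mxE big1 // => z _; rewrite mxE.
  have [zx|/vS ->] := boolP (z \in ball G x i); last by rewrite mul0r.
  have [zy|/wS ->] := boolP (z \in ball G y i); last by rewrite mulr0.
  by have [] := far z z zx zy; rewrite eqxx.
have vn0 : v != 0.
  by apply/eqP => v0; move: vgt; rewrite v0 /qform /sqnorm !mul0mx mxE mulr0 ltxx.
have wn0 : w != 0.
  by apply/eqP => w0; move: wgt; rewrite w0 /qform /sqnorm !mul0mx mxE mulr0 ltxx.
have sqadd a b : sqnorm (a *: v + b *: w) = a ^+ 2 * sqnorm v + b ^+ 2 * sqnorm w.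
  have := qform_addZ a b v w (trmx1 R n); rewrite /qform !mulmx1 vw.
  by rewrite /sqnorm => ->; rewrite mulr0 addr0.
pose V := col_mx v w.
have VE (u : 'rV_n) : (u <= V)%MS -> exists a b, u = a *: v + b *: w.
  case/submxP => c ->; rewrite -[c]hsubmxK mul_row_col.
  exists (lsubmx c 0 0), (rsubmx c 0 0).
  by rewrite -!mul_scalar_mx -!mx11_scalar.
have rV : \rank V = 2%N.
  apply/eqP; rewrite -[_ == _]/(row_free V); apply/row_freeP/row_freeP.
  rewrite -kermx_eq0; apply/eqP/row_matrixP => j; rewrite row0.
  have := row_sub j (kermx V); move/sub_kermxP; move: (row j _) => c.
  rewrite -[c]hsubmxK mul_row_col [lsubmx c]mx11_scalar [rsubmx c]mx11_scalar.
  move: (lsubmx c 0 0) (rsubmx c 0 0) => a b; rewrite !mul_scalar_mx => e0.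
  have /eqP := sqadd a b; rewrite e0 {1}/sqnorm mul0mx mxE eq_sym paddr_eq0; last 2 first.
  - by rewrite mulr_ge0 ?sqr_ge0 ?sqnorm_ge0.
  - by rewrite mulr_ge0 ?sqr_ge0 ?sqnorm_ge0.
  rewrite !mulf_eq0 !sqnorm_eq0 (negbTE vn0) (negbTE wn0) !orbF !orbb.
  by case/andP => /eqP -> /eqP ->; rewrite !raddf0 row_mx0.
have : (2 <= count (> lambda2)%R (spectrum N))%N.
  rewrite -[X in (X <= _)%N]rV; apply: rank_le_count_gt => // u /VE[a [b ->]] un0.
  rewrite (qform_addZ _ _ _ _ N_sym) vMw mulr0 addr0 sqadd.
  have -> : lambda2 * (a ^+ 2 * sqnorm v + b ^+ 2 * sqnorm w) =
    a ^+ 2 * (lambda2 * sqnorm v) + b ^+ 2 * (lambda2 * sqnorm w) by ring.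
  have [a0|an0] := eqVneq a 0; first have [b0|bn0] := eqVneq b 0.
  - by move: un0; rewrite a0 b0 !scale0r addr0 eqxx.
  - by apply: ler_ltD; rewrite ?ltr_pM2l ?exprn_even_gt0 // ler_wpM2l ?sqr_ge0 // ltW.
  - by apply: ltr_leD; rewrite ?ltr_pM2l ?exprn_even_gt0 // ler_wpM2l ?sqr_ge0 // ltW.
by move=> h; have := leq_trans h (count_gt_second N).
Qed.

Definition large_ball_centers i : {set 'I_n} :=
  [set x | ~~ `[< qform_le N (ball G x i) lambda2 >]].

Lemma notin_large_ball_centers x i :
  x \notin large_ball_centers i -> qform_le N (ball G x i) lambda2.
Proof. by rewrite inE negbK => /asboolP. Qed.

(** By [large_balls_close], all these centers lie in one ball around any of them. *)
Lemma card_large_ball_centers i :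
  (#|large_ball_centers i| <= Delta.+1 ^ (i + i).+1)%N.
Proof.
have [->|[x]] := set_0Vmem (large_ball_centers i); first by rewrite cards0.
rewrite inE => /asboolPn xU; apply: leq_trans (card_ball degG x _).
apply/subset_leq_card/subsetP => y; rewrite inE => /asboolPn yU.
exact: large_balls_close.
Qed.

(** A ball of positive radius contains an edge at [x], and the form is positive on the indicator of
    its two ends. *)
Lemma lambda2_gt0 x i : (1 < n)%N -> (0 < i)%N ->
  qform_le N (ball G x i) lambda2 -> 0 < lambda2.
Proof.
move=> n1 i0 le.
have [y xy] : exists y, y != x.
  apply/existsP; rewrite -negb_forall; apply/negP => /forallP h.
  have : (#|'I_n| <= #|[set x]|)%N.
    by apply/subset_leq_card/subsetP => y _; rewrite inE; apply/eqP; exact/eqP/h.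
  by rewrite cards1 card_ord leqNgt n1.
have [z [xz nzx]] : exists z, adjacent G x z /\ z != x.
  have xS : x \in [set x] by rewrite inE.
  have yS : y \notin [set x] by rewrite inE.
  have [p [xp _ sp lp]] := exit_path (connG x y) xS yS.
  move: sp xp lp; rewrite cards1; case: p => [|z [|]] //=; first by rewrite inE eqxx.
  by rewrite andbT inE => _ xz zx; exists z.
pose v : 'rV[R]_n := \row_j ((j == x)%:R + (j == z)%:R).
have vS : supported (ball G x i) v.
  move=> j jB; rewrite mxE; have [jx|_] := eqVneq j x.
    by rewrite jx ball_center in jB.
  have [jz|_] := eqVneq j z; last by rewrite addr0.
  have : z \in ball G x 1 by apply: ball_adj xz; rewrite inE.
  by move/(subsetP (ball_leq G x i0)); rewrite -jz (negbTE jB).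
have v0 j : 0 <= v 0 j by rewrite mxE addr_ge0.
have : 0 < qform N v.
  rewrite qformE (bigD1 x) //= ltr_pwDl //; last first.
    by apply: sumr_ge0 => j _; apply: sumr_ge0 => k _; rewrite !mulr_ge0.
  rewrite (bigD1 z) //= ltr_pwDl //; last first.
    by apply: sumr_ge0 => k _; rewrite !mulr_ge0.
  have v1 j : (j == x) || (j == z) -> 0 < v 0 j.
    by rewrite mxE; case: (j == x); case: (j == z) => //= _;
      rewrite ?addr0 ?add0r ?addr_gt0 ?ltr01.
  rewrite !mulr_gt0 ?v1 ?eqxx ?orbT // normalized_adjacencyE.
  by rewrite !mulr_gt0 ?invr_gt0 ?sqrtr_gt0 ?ltr0n.
move/lt_le_trans/(_ (le v vS)) => h; move: (h).
rewrite pmulr_lgt0 // sqnorm_gt0; apply/eqP => v_eq0; move: h.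
by rewrite v_eq0 /sqnorm mul0mx mxE mulr0 ltxx.
Qed.

End SecondEigenvalue.

(** * Random deletion *)

Lemma leq_exp2r_le m n e : (m <= n)%N -> (m ^ e <= n ^ e)%N.
Proof. by case: e => // e mn; rewrite leq_exp2r. Qed.

Section RandomDeletion.
Variables (R : realType) (n : nat) (G : multigraph n) (Delta : nat).
Hypothesis connG : graph_connected G.
Hypothesis degG : forall i, (degree G i <= Delta)%N.
Hypothesis deg_gt0 : forall i, (0 < degree G i)%N.

Local Notation N := (normalized_adjacency_mx R G).
Let N_ge0 := normalized_adjacency_ge0 R G.
Let N_sym := normalized_adjacency_sym R G.

Lemma path_walk_weight x p : walk_weight N x p != 0 -> path (adjacent G) x p.
Proof.
elim: p x => [//|y p IHp] x /=; rewrite mulf_eq0 negb_or => /andP[xy /IHp ->].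
rewrite andbT /adjacent lt0n; apply: contra xy => /eqP xy.
by rewrite normalized_adjacencyE xy !mul0r.
Qed.

Variables (k s : nat) (mu : R).
Hypotheses (k_gt0 : (0 < k)%N) (s_gt0 : (0 < s)%N) (sk : (s <= k)%N)
  (sn : (s + s < n)%N) (mu_ge0 : 0 <= mu).

Local Notation W x p := (walk_weight N x p).
Local Notation closed x := (fun p => last x p == x).
Local Notation growth := ((1 + gain R Delta (s + s)) ^+ s).

Let W_ge0 x p : 0 <= W x p. Proof. exact: walk_weight_ge0. Qed.
Let k2 : (0 < k.*2)%N. Proof. by rewrite double_gt0. Qed.


(** A walk of length [2k] from [x] stays in the ball, so the sum is bounded by a diagonal entry of a
    power of the masked matrix. *)
Lemma closed_walks_le x : qform_le N (ball G x k.*2) mu ->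
  \sum_(p <- walks n k.*2 | closed x p) W x p <= mu ^+ k.*2.
Proof.
move=> le; apply: le_trans (mask_expmx_diag_le k x N_sym N_ge0 mu_ge0 le).
rewrite expmx_walks big_seq_cond [leRHS]big_seq_cond; apply: ler_sum => p.
case/andP => /size_walks sp _; rewrite walk_weight_mask ?sp //.
have [->|/path_walk_weight xp] := eqVneq (W x p) 0; first by rewrite if_same.
by rewrite -sp walk_supportE (introT allP (path_ball xp)).
Qed.

(** Union bound over the grown sets. Each has at most [s] vertices and lies within radius [s - 1],
    and [s <= k] leaves room for [s] more growth steps inside radius [2k]. *)
Lemma small_closed_walks_le x : qform_le N (ball G x k.*2) mu ->
  \sum_(p <- walks n k.*2 | closed x p && (#|walk_support x p| <= s)%N) W x p <=
  ((s * Delta).+1 ^ s)%:R * (mu / growth) ^+ k.*2.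
Proof.
move=> le; set F := grown_sets G x s.-1.
have g0 : 0 <= gain R Delta (s + s) by rewrite invr_ge0 !mulr_ge0 ?exprn_ge0.
have mug : 0 <= mu / growth by rewrite divr_ge0 ?exprn_ge0 // addr_ge0.
apply: (@le_trans _ _ (\sum_(T <- F) (mask_mx T N ^+ k.*2) x x)); last first.
  rewrite big_seq.
  apply: (@le_trans _ _ (\sum_(T <- F | T \in F) (mu / growth) ^+ k.*2)).
    apply: ler_sum => T /grown_setsP[cT sT].
    apply: mask_expmx_diag_le => //.
    apply: (@qform_le_iter _ _ _ deg_gt0 _ connG degG (ball G x) _ _ _ s.-1) => //.
    - by move=> *; apply: ball_adj; eassumption.
    - by move=> i; apply: ball_sub.
    - by rewrite leq_add2r (leq_trans cT) // prednK.
    - apply: qform_le_sub le; apply: ball_leq.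
      by rewrite -addnn leq_add // (leq_trans (leq_pred _)).
  rewrite -big_seq big_const_seq count_predT iter_addr_0 -[_ *+ _]mulr_natl.
  rewrite ler_wpM2r ?exprn_ge0 // ler_nat.
  apply: leq_trans (size_grown_sets degG x (leq_pred s)) _.
  by rewrite leq_pexp2l // leq_pred.
under [leRHS]eq_bigr do rewrite expmx_walks.
rewrite exchange_big /= big_seq_cond [leRHS]big_seq_cond.
rewrite (eq_bigl (fun p => ((p \in walks n k.*2) && closed x p) &&
   (#|walk_support x p| <= s)%N)); last by move=> p; rewrite andbA.
rewrite big_mkcondr /=; apply: ler_sum => p /andP[/size_walks sp _].
have sum0 F' : 0 <= \sum_(T <- F') walk_weight (mask_mx T N) x p.
  by apply: sumr_ge0 => T _; apply: walk_weight_ge0 => *; apply: mask_mx_ge0.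
case: leqP => // ps; have [->//|/path_walk_weight xp] := eqVneq (W x p) 0.
have pF : walk_support x p \in F.
  apply: (grown_sets_leq _ (walk_support_grown xp)); rewrite -!subn1.
  exact: leq_sub2r.
rewrite (big_rem _ pF) /= walk_weight_mask ?sp // subxx lerDl.
exact: sum0.
Qed.

Lemma card_avoiding J (T : {set 'I_n}) :
  #|[pred Y : {ffun 'I_J -> 'I_n} | [forall j, Y j \notin T]]| = ((n - #|T|) ^ J)%N.
Proof.
have -> : (n - #|T|)%N = #|mem (~: T)|.
  have h : (#|T| + #|~: T| = n)%N by rewrite cardsC card_ord.
  by rewrite -[RHS](addKn #|T|) h.
rewrite -[J in RHS](card_ord J) -card_ffun_on; apply: eq_card => Y.
by rewrite !inE; apply: eq_forallb => j; rewrite !inE.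
Qed.

(** First moment method: the trace is averaged over all [J]-tuples [Y] of vertices, repetitions
    allowed. Deleting [U] leaves only starting points with controlled balls, and a walk visiting
    more than [s] vertices is missed by at most a fraction [(1 - s / n) ^+ J] of the tuples. *)
Lemma exists_deletion J (U : {set 'I_n}) :
  (forall x, x \notin U -> qform_le N (ball G x k.*2) mu) ->
  exists D : {set 'I_n}, (#|D| <= #|U| + J)%N /\
    \tr (mask_mx (~: D) N ^+ k.*2) <=
    n%:R * (((s * Delta).+1 ^ s)%:R * (mu / growth) ^+ k.*2
            + (1 - s%:R / n%:R) ^+ J * mu ^+ k.*2).
Proof.
move=> hU; pose Ff := {ffun 'I_J -> 'I_n}.
pose D (Y : Ff) := U :|: [set Y j | j : 'I_J].
set c := _ + _; have n0 : (0 < n)%N by apply: leq_ltn_trans sn.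
have nR : 0 < n%:R :> R by rewrite ltr0n.
have cardD Y : (#|D Y| <= #|U| + J)%N.
  apply: leq_trans (leq_card_setU _ _) _; rewrite leq_add2l.
  by apply: leq_trans (leq_imset_card _ _) _; rewrite card_ord.
pose avoid (Y : Ff) T := [forall j, Y j \notin (T : {set 'I_n})].
have trD Y : \tr (mask_mx (~: D Y) N ^+ k.*2) <=
    \sum_(x in ~: U) \sum_(p <- walks n k.*2 | closed x p)
      W x p * (avoid Y (walk_support x p))%:R.
  rewrite /mxtrace (bigID (mem (~: U))) /= [X in _ + X]big1 => [|x]; last first.
    rewrite inE negbK => xU; rewrite expmx_walks big_seq_cond big1 // => p.
    case/andP => /size_walks sp _; rewrite walk_weight_mask ?sp // ifF //.
    by apply/negP => /subsetP/(_ x); rewrite !inE eqxx xU => /(_ isT).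
  rewrite addr0; apply: ler_sum => x _; rewrite expmx_walks.
  rewrite big_seq_cond [leRHS]big_seq_cond; apply: ler_sum => p.
  case/andP => /size_walks sp _; rewrite walk_weight_mask ?sp //.
  case: ifP => [/subsetP sD|_]; last by rewrite mulr_ge0.
  suff -> : avoid Y (walk_support x p) by rewrite mulr1.
  apply/forallP => j; apply/negP => /sD; rewrite !inE negb_or => /andP[_ /negP].
  by apply; apply/imsetP; exists j.
have card_avoid T : \sum_(Y : Ff) (avoid Y T)%:R = ((n - #|T|) ^ J)%:R :> R.
  rewrite -card_avoiding -sum1_card natr_sum [RHS]big_mkcond /=.
  by apply: eq_bigr => Y _; rewrite inE /avoid; case: ifP.
have nJ : (n ^ J)%:R = #|Ff|%:R :> R by rewrite card_ffun !card_ord.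
have sumY : \sum_(Y : Ff) \tr (mask_mx (~: D Y) N ^+ k.*2) <= \sum_(Y : Ff) n%:R * c.
  rewrite sumr_const -[_ *+ _]mulr_natl -nJ.
  apply: le_trans (ler_sum _ (fun Y _ => trD Y)) _.
  rewrite exchange_big /=.
  apply: (@le_trans _ _ (\sum_(x in ~: U) (n ^ J)%:R * c)); last first.
    rewrite sumr_const -[_ *+ _]mulr_natl mulrCA ler_wpM2l //.
    have c0 : 0 <= c.
      have g0 : 0 <= gain R Delta (s + s) by rewrite invr_ge0 !mulr_ge0 ?exprn_ge0.
      apply: addr_ge0; apply: mulr_ge0; rewrite ?exprn_ge0 //.
        by rewrite divr_ge0 // exprn_ge0 // addr_ge0.
      by rewrite subr_ge0 ler_pdivrMr // mul1r ler_nat ltnW // (leq_ltn_trans _ sn) ?leq_addr.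
    by rewrite ler_wpM2r // ler_nat (leq_trans (max_card _)) ?card_ord.
  apply: ler_sum => x; rewrite inE => /hU le.
  rewrite exchange_big /=; under eq_bigr do rewrite -mulr_sumr card_avoid.
  (* Walks with small support are bounded as if no tuple hit them; only those with large support use
     the deletion. *)
  rewrite (bigID (fun p => #|walk_support x p| <= s)%N) /= mulrDr lerD //.
    apply: (@le_trans _ _ ((n ^ J)%:R *
      \sum_(p <- walks n k.*2 | closed x p && (#|walk_support x p| <= s)%N) W x p)).
      rewrite mulr_sumr; apply: ler_sum => p _; rewrite mulrC ler_wpM2r //.
      by rewrite ler_nat leq_exp2r_le // leq_subr.
    by rewrite ler_wpM2l // small_closed_walks_le.
  have -> : (n ^ J)%:R * ((1 - s%:R / n%:R) ^+ J * mu ^+ k.*2)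
      = ((n - s) ^ J)%:R * mu ^+ k.*2.
    rewrite mulrA !natrX -exprMn natrB; last first.
      by rewrite ltnW // (leq_ltn_trans _ sn) ?leq_addr.
    by congr (_ ^+ _ * _); field; rewrite gt_eqF.
  apply: (@le_trans _ _ (((n - s) ^ J)%:R *
    \sum_(p <- walks n k.*2 | closed x p) W x p)); last first.
    by rewrite ler_wpM2l // closed_walks_le.
  rewrite mulr_sumr [leRHS](bigID (fun p => #|walk_support x p| <= s)%N) /=.
  rewrite ler_wpDl ?sumr_ge0 // => [p _|]; first by rewrite mulr_ge0.
  apply: ler_sum => p /andP[_]; rewrite -ltnNge => ps; rewrite mulrC ler_wpM2r //.
  by rewrite ler_nat leq_exp2r_le // leq_sub2l // ltnW.
have [Y hY] : exists Y : Ff, \tr (mask_mx (~: D Y) N ^+ k.*2) <= n%:R * c.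
  apply: contrapT => /forallNP none; move: sumY; apply/negP; rewrite -ltNge.
  apply: ltr_sum => [|Y _].
    by apply/hasP; exists [ffun=> Ordinal n0]; rewrite ?mem_index_enum.
  by rewrite ltNge; apply/negP/none.
by exists (D Y).
Qed.

End RandomDeletion.

Lemma degree_gt0 n (G : multigraph n) : (1 < n)%N -> graph_connected G ->
  forall i, (0 < degree G i)%N.
Proof.
move=> n1 connG x.
have [y yx] : exists y, y \notin [set x].
  apply/existsP; rewrite -negb_forall; apply/negP => /forallP h.
  have : (#|'I_n| <= #|[set x]|)%N by apply/subset_leq_card/subsetP => y _.
  by rewrite cards1 card_ord leqNgt n1.
have [[|z p] [/= xp _ _ lp]] := exit_path (connG x y) (set11 x) yx.
  by rewrite set11 in lp.
case/andP: xp => xz _; rewrite /degree (bigD1 z) //=.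
exact: leq_trans xz (leq_addr _ _).
Qed.

Lemma degree_le_max n (G : multigraph n) i : (degree G i <= max_degree G)%N.
Proof. exact: leq_bigmax. Qed.

(** * The eigenvalue count with free parameters *)

Section EigenCount.
Variables (R : realType) (n : nat) (G : multigraph n).
Hypothesis connG : graph_connected G.

Local Notation lambda2 := (lambda R G 2).
Local Notation Delta := (max_degree G).

Lemma eigen_count_le_size (I : interval R) : (eigen_count G I <= n)%N.
Proof.
rewrite /eigen_count (leq_trans (count_size _ _)) //.
by rewrite (size_spectrum (normalized_adjacency_sym R G)).
Qed.

Lemma eigen_count_le k s J (eps : R) :
  (0 < s)%N -> (s <= k)%N -> (s + s < n)%N ->
  (Delta.+1 ^ (4 * k).+1 < n)%N -> 0 <= eps -> eps < 1 ->
  (eigen_count G `[(1 - eps) * lambda2, lambda2])%:R <=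
  (Delta.+1 ^ (4 * k).+1)%:R + J%:R +
  n%:R * (((s * Delta).+1 ^ s)%:R / ((1 + gain R Delta (s + s)) ^+ s) ^+ k.*2
          + (1 - s%:R / n%:R) ^+ J) / (1 - eps) ^+ k.*2.
Proof.
move=> s0 sk sn Un eps0 eps1.
have n1 : (1 < n)%N by apply: leq_ltn_trans sn; rewrite addn_gt0 s0.
have deg0 := degree_gt0 n1 connG; have degD := degree_le_max G.
have k0 : (0 < k)%N by apply: leq_trans sk.
set U := large_ball_centers R G k.*2.
have cU : (#|U| <= Delta.+1 ^ (4 * k).+1)%N.
  have := card_large_ball_centers R degD k.*2.
  by rewrite (_ : k.*2 + k.*2 = 4 * k)%N //; lia.
have [x xU] : exists x, x \notin U.
  apply/existsP; rewrite -negb_forall; apply/negP => /forallP h.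
  have : (#|'I_n| <= #|U|)%N by apply/subset_leq_card/subsetP => y _; apply: h.
  by rewrite card_ord leqNgt (leq_ltn_trans cU).
(* Fewer than [n] centers are bad, and a single good one makes [lambda2] positive, so that
   [lambda2 ^+ k.*2] can be cancelled at the end. *)
have l0 : 0 < lambda2.
  apply: (lambda2_gt0 connG deg0 n1 (i := k.*2)); last exact: notin_large_ball_centers xU.
  by rewrite double_gt0.
have [D [cD trD]] := exists_deletion connG degD deg0 k0 s0 sk sn (ltW l0) J
  (fun y (yU : y \notin U) => notin_large_ball_centers yU).
set N := normalized_adjacency_mx R G in trD *.
have symN := normalized_adjacency_sym R G.
have mu0 : 0 < (1 - eps) * lambda2 by rewrite mulr_gt0 // subr_gt0.
set I := `[(1 - eps) * lambda2, lambda2].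
pose q := count (>= ((1 - eps) * lambda2)) (spectrum (mask_mx (~: D) N)).
have cnt : (eigen_count G I <= #|D| + q)%N.
  apply: count_interlacing => //; first exact: mask_mx_sym.
    by move=> y; rewrite in_itv /= => /andP[].
  by move=> v vD; apply: qform_mask => i; rewrite inE negbK; apply: vD.
apply: (@le_trans _ _ ((#|U| + J) + q)%:R).
  by rewrite ler_nat (leq_trans cnt) // leq_add2r.
rewrite natrD natrD !lerD ?ler_nat //.
have := count_spectrum_le_mxtrace (mask_mx_sym (~: D) symN) k (ltW mu0).
rewrite -/q => /le_trans/(_ trD); rewrite expr_div_n exprMn.
rewrite mulrA => h.
rewrite ler_pdivlMr ?exprn_gt0 ?subr_gt0 // -(ler_pM2r (exprn_gt0 k.*2 l0)).
apply: le_trans h _; rewrite -!mulrA ler_wpM2l // mulrDl !mulrA.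
rewrite le_eqVlt; apply/orP; left; apply/eqP; congr (_ + _).
by rewrite -!mulrA; congr (_ * _); rewrite mulrC.
Qed.

End EigenCount.

(** * Choice of parameters *)

Section Estimates.
Variable R : realType.
Implicit Types (x y g e : R).

Lemma expR_half_le g : 0 <= g <= 1 -> expR (g / 2) <= 1 + g.
Proof.
case/andP => g0 g1; rewrite -[expR _]invrK -expRN.
have h : 1 - g / 2 <= expR (- (g / 2)) by apply: expR_ge1Dx.
have p : 0 < 1 - g / 2 by lra.
apply: (@le_trans _ _ (1 - g / 2)^-1).
  by rewrite lef_pV2 ?posrE ?expR_gt0.
by rewrite -[_^-1]mul1r ler_pdivrMr //; nra.
Qed.

Lemma expRN_double_le e : 0 <= e <= 2^-1 -> expR (- (2 * e)) <= 1 - e.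
Proof.
case/andP => e0 e1; rewrite expRN.
have h : 1 + 2 * e <= expR (2 * e) by apply: expR_ge1Dx.
have p : 0 < 1 + 2 * e by lra.
apply: (@le_trans _ _ (1 + 2 * e)^-1).
  by rewrite lef_pV2 ?posrE ?expR_gt0.
by rewrite -[_^-1]mul1r ler_pdivrMr //; nra.
Qed.

Lemma ln_le_half x : 1 <= x -> ln x <= x / 2.
Proof.
move=> x1; have x0 : 0 < x by lra.
rewrite -ler_expR lnK ?posrE //.
have h := expR_ge1Dx (x / 4).
have -> : x / 2 = 2 * (x / 4) by lra.
rewrite expRM_natl.
apply: (@le_trans _ _ ((1 + x / 4) ^+ 2)); first by have := sqr_ge0 (1 - x / 4); lra.
by rewrite lerXn2r ?nnegrE ?expR_ge0 //; lra.
Qed.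

Lemma cube_le_expR x : 256 <= x -> x ^+ 3 <= expR x.
Proof.
move=> x256; have h := expR_ge1Dx (x / 4).
have -> : expR x = expR (x / 4) ^+ 4.
  by rewrite -expRM_natl; congr expR; lra.
apply: (@le_trans _ _ ((x / 4) ^+ 4)); last first.
  by rewrite lerXn2r ?nnegrE ?expR_ge0 //; lra.
have -> : (x / 4) ^+ 4 = x ^+ 3 * (x / 256) by field.
by rewrite ler_peMr ?exprn_ge0; lra.
Qed.

Variables (n Delta s k : nat).
Local Notation l := (ln n%:R : R).
Local Notation ll := (ln l).
Local Notation D := (Delta%:R : R).
Local Notation L := (logb D n%:R : R).
Hypothesis l_ge : 256 <= l.

Let l_gt0 : 0 < l. Proof. exact: lt_le_trans l_ge. Qed.

Lemma expR_ln_natr : expR l = n%:R.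
Proof.
rewrite lnK // posrE; rewrite ltNge; apply/negP => n0.
by have := l_gt0; rewrite ln0 // ltxx.
Qed.

Let nR_gt0 : 0 < n%:R :> R. Proof. by rewrite -expR_ln_natr expR_gt0. Qed.

(** The numerator is at most [expR (s * ll)] and the denominator at least [expR (g * s * k)] with
    [g * k >= 3 * ll]. Here 3072 is 3 times 1024, and 1024 is the 32 of [gain] times the [2 ^ 5]
    from [(s + s) ^ 5]. *)
Lemma support_count_le : 1 <= ll -> (0 < s)%N -> (0 < Delta)%N -> s%:R * D + 1 <= l ->
  3072 * ll * D ^+ 4 * s%:R ^+ 5 <= k%:R ->
  ((s * Delta).+1 ^ s)%:R / ((1 + gain R Delta (s + s)) ^+ s) ^+ k.*2 <= l ^- 2.
Proof.
move=> ll_ge1 s0 D0 sD hk; set g := gain R Delta (s + s).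
have sR : 1 <= s%:R :> R by rewrite ler1n.
have DR : 1 <= D by rewrite ler1n.
have P0 : 1 <= D ^+ 4 * s%:R ^+ 5 by rewrite mulr_ege1 ?exprn_ege1.
have gE : g = (1024 * (D ^+ 4 * s%:R ^+ 5))^-1.
  by rewrite /g /gain natrD; congr (_^-1); ring.
have g01 : 0 <= g <= 1.
  by rewrite gE invr_ge0 invf_le1; lra.
have num : ((s * Delta).+1 ^ s)%:R <= expR (s%:R * ll).
  rewrite expRM_natl lnK ?posrE // natrX lerXn2r ?nnegrE ?(ltW l_gt0) //.
  by rewrite -addn1 natrD natrM.
have den : expR (g * s%:R * k%:R) <= ((1 + g) ^+ s) ^+ k.*2.
  have -> : g * s%:R * k%:R = (s * k.*2)%:R * (g / 2).
    by rewrite natrM -muln2 natrM; field.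
  rewrite -exprM expRM_natl lerXn2r ?nnegrE ?expR_ge0 ?expR_half_le //.
  by case/andP: g01; lra.
have -> : l ^- 2 = expR (- (2 * ll)).
  by rewrite expRN expRM_natl lnK // posrE.
rewrite ler_pdivrMr; last by apply: lt_le_trans den; rewrite expR_gt0.
apply: le_trans num _; apply: le_trans (ler_wpM2l (expR_ge0 _) den).
rewrite -expRD ler_expR.
have h : 3 * ll <= g * k%:R.
  rewrite gE [leRHS]mulrC ler_pdivlMr; last by lra.
  by apply: le_trans hk; rewrite le_eqVlt; apply/orP; left; apply/eqP; ring.
have := ler_wpM2r (ler0n R s) h; have : 0 <= (s%:R - 1) * ll.
  by apply: mulr_ge0; [lra|exact: le_trans ll_ge1].
by lra.
Qed.

Lemma miss_probability_le J : (0 < s)%N -> (s <= n)%N ->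
  2 * ll * n%:R / s%:R <= J%:R -> (1 - s%:R / n%:R) ^+ J <= l ^- 2.
Proof.
move=> s0 sn hJ; have sR : 0 < s%:R :> R by rewrite ltr0n.
have -> : l ^- 2 = expR (- (2 * ll)).
  by rewrite expRN expRM_natl lnK // posrE.
have q : s%:R / n%:R <= 1 :> R by rewrite ler_pdivrMr // mul1r ler_nat.
apply: (@le_trans _ _ (expR (- (s%:R / n%:R)) ^+ J)).
  by rewrite lerXn2r ?nnegrE ?expR_ge0 ?subr_ge0 // expR_ge1Dx.
rewrite -expRM_natl ler_expR mulrN lerN2.
have -> : 2 * ll = 2 * ll * n%:R / s%:R * (s%:R / n%:R).
  by field; rewrite !gt_eqF.
by rewrite ler_wpM2r // divr_ge0.
Qed.

Hypotheses (Delta_ge2 : (2 <= Delta)%N) (k_le : k%:R <= L / 16).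

Let D_ge2 : 2 <= D. Proof. by rewrite (ler_nat R 2). Qed.
Let lnD_gt0 : 0 < ln D. Proof. by rewrite ln_gt0 //; have := D_ge2; lra. Qed.

(** [Delta + 1 <= Delta ^ 2] bounds the left side by [D ^+ (8 * k + 2)]. After squaring,
    [k <= L / 16] gives [D ^+ (16 * k) <= n], and the remaining [D ^+ 4 <= l] is absorbed by
    [l ^+ 3 <= n]. *)
Lemma large_ball_le : D ^+ 4 <= l -> (Delta.+1 ^ (4 * k).+1)%:R <= n%:R / l.
Proof.
move=> D4; apply: (@le_trans _ _ (D ^+ (8 * k) * D ^+ 2)).
  rewrite -exprD -natrX ler_nat (_ : 8 * k + 2 = 2 * (4 * k).+1)%N; last by lia.
  by rewrite expnM leq_exp2r_le //; nia.
have X0 : 0 <= D ^+ (8 * k) * D ^+ 2 by rewrite mulr_ge0 ?exprn_ge0.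
rewrite -(@ler_pXn2r _ 2) ?nnegrE ?divr_ge0 ?(ltW l_gt0) //.
have DE : D = expR (ln D) by rewrite lnK // posrE; have := D_ge2; lra.
have D16 : (D ^+ (8 * k)) ^+ 2 <= n%:R.
  rewrite -exprM -expR_ln_natr {1}DE -expRM_natl ler_expR.
  have e : (8 * k * 2)%:R = 16 * k%:R :> R by rewrite -natrM; congr (_%:R); lia.
  have : k%:R * ln D <= l / 16.
    have -> : l / 16 = L / 16 * ln D by rewrite /logb; field; rewrite gt_eqF.
    by rewrite ler_wpM2r // ltW.
  by rewrite e; lra.
rewrite exprMn; apply: (@le_trans _ _ (n%:R * l)).
  apply: ler_pM => //; first exact: exprn_ge0 (exprn_ge0 _ _).
    by rewrite exprn_ge0 // exprn_ge0.
  by rewrite -exprM.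
have c := cube_le_expR l_ge; rewrite expR_ln_natr in c.
rewrite expr_div_n ler_pdivlMr ?exprn_gt0 //.
have -> : n%:R * l * l ^+ 2 = n%:R * l ^+ 3 by ring.
by rewrite expr2 ler_wpM2l.
Qed.

Lemma eps_bounds : 1 < L -> 0 <= ln L / L <= 2^-1.
Proof.
move=> L1; have L0 : 0 < L by lra.
rewrite divr_ge0 ?ln_ge0 ?(ltW L0) ?(ltW L1) //= ler_pdivrMr //.
by have := ln_le_half (ltW L1); lra.
Qed.

(** With [e = ln L / L], the power [(1 - e) ^+ k.*2] is at least [expR (- (4 * k * e))], hence at
    least [1 / L] because [k <= L / 16]; and [L <= 2 * l] because [ln D >= 1 / 2]. The width of the
    interval is tuned to this polynomial loss. *)
Lemma interval_loss_le : 1 < L -> (1 - ln L / L) ^- k.*2 <= 2 * l.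
Proof.
move=> L1; have L0 : 0 < L by lra.
have /andP[e0 e1] := eps_bounds L1; set e := ln L / L in e0 e1 *.
have h : expR (- ln L) <= (1 - e) ^+ k.*2.
  apply: (@le_trans _ _ (expR (- (2 * e)) ^+ k.*2)); last first.
    by rewrite lerXn2r ?nnegrE ?expR_ge0 ?expRN_double_le ?e0 //; lra.
  rewrite -expRM_natl ler_expR -muln2 natrM mulrN lerN2.
  have : k%:R * e <= L / 16 * e by rewrite ler_wpM2r.
  have -> : L / 16 * e = ln L / 16 by rewrite /e; field; rewrite gt_eqF.
  by have := ln_ge0 (ltW L1); lra.
apply: (@le_trans _ _ (expR (- ln L))^-1).
  by rewrite lef_pV2 ?posrE ?expR_gt0 // exprn_gt0; lra.
rewrite expRN invrK lnK ?posrE // /logb ler_pdivrMr //.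
have : 2^-1 <= ln D.
  apply: (@le_trans _ _ (ln 2)); last by rewrite ler_ln ?posrE //; have := D_ge2; lra.
  rewrite -ler_expR lnK ?posrE //; have := @expR_half_le 1.
  by rewrite div1r; apply; lra.
have := l_gt0; nra.
Qed.

End Estimates.

(** [s] is the integer part of the fifth root [r], and [r < s + 1 <= 2 * s]. *)
Lemma fifth_root_approx (R : realType) (y : R) : 1 <= y ->
  exists s : nat, [/\ (0 < s)%N, s%:R ^+ 5 <= y & y < (2 * s%:R) ^+ 5].
Proof.
move=> y1; have y0 : 0 <= y by lra.
pose r := y `^ (1 / 5).
have r5 : r ^+ 5 = y.
  by rewrite -powR_mulrn ?powR_ge0 // -powRrM mul1r mulVf ?pnatr_eq0 // powRr1.
have r0 : 0 <= r by apply: powR_ge0.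
have r1 : 1 <= r.
  rewrite leNgt; apply/negP => r1; have : r ^+ 5 < 1 by rewrite exprn_ilt1.
  by rewrite r5; lra.
have /andP[h1 h2] := truncn_itv r0.
exists (Num.truncn r); rewrite truncn_gt0 r1; split=> //.
  by rewrite -r5 lerXn2r ?nnegrE.
have s1 : 1 <= (Num.truncn r)%:R :> R by rewrite ler1n truncn_gt0.
by rewrite -r5 ltrXn2r //; move: h2; rewrite -(@natr1 _ (Num.truncn r)); lra.
Qed.

Lemma gt1_of_exp5_gt1 (R : realType) (x : R) : 0 <= x -> 1 < x ^+ 5 -> 1 < x.
Proof.
move=> x0 h; rewrite ltNge; apply/negP => x1.
by have := exprn_ile1 5 x0 x1; lra.
Qed.

Section RealArithmetic.
Variable R : realType.

Lemma powR_ratio_exp5 (D l : R) : 0 <= D -> 0 < l ->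
  (D `^ (7 / 5) / l `^ (1 / 5)) ^+ 5 = D ^+ 7 / l.
Proof.
move=> D0 l0; rewrite expr_div_n -!powR_mulrn ?powR_ge0 // -?powRrM.
rewrite (_ : 7 / 5 * 5%:R = 7%:R :> R); last by field.
by rewrite (_ : 1 / 5 * 5%:R = 1 :> R) ?powRr1 ?(ltW l0) //; field.
Qed.

(** Comparing fifth powers avoids real exponents; [c <= c ^+ 5] costs only a power of [ll] when
    [c = K * ll]. It is applied with [x = 1] when no [s] fits and with [x = 2 * s] otherwise. *)
Lemma exp5_gap (c d l w x : R) : 1 <= c -> 0 < d -> 0 < l -> 0 <= w -> 0 <= x ->
  w ^+ 5 = d / l -> l / (c * d) < x ^+ 5 -> 1 < x * (c * w).
Proof.
move=> c1 d0 l0 w0 x0 w5 lt; have c0 : 0 < c by lra.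
apply: gt1_of_exp5_gt1; first by rewrite !mulr_ge0 // ltW.
rewrite exprMn [(c * w) ^+ 5]exprMn w5.
apply: (@lt_le_trans _ _ (x ^+ 5 * (c * (d / l)))).
  have -> : x ^+ 5 * (c * (d / l)) = x ^+ 5 * (c * d) / l by ring.
  by move: lt; rewrite ltr_pdivrMr ?mulr_gt0 // ltr_pdivlMr // mul1r.
apply: ler_wpM2l; first exact: exprn_ge0.
apply: ler_wpM2r; first by rewrite divr_ge0 ?ltW.
by rewrite exprS ler_peMr ?exprn_ege1 // ltW.
Qed.

(** [A] is, up to a constant, the walk length that [support_count_le] demands. The side conditions
    on [s] and [D] then follow by comparison with [A]. *)
Lemma support_size_bounds (D ll s l : R) : 2 <= D -> 1 <= ll -> 1 <= s ->
  s ^+ 5 * (3072 * 32 * ll * D ^+ 7) <= l ->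
  let A := ll * (D ^+ 4 * s ^+ 5) in
  [/\ 1 <= A, 3072 * 32 * A <= l / D, s <= A, D ^+ 4 <= A & s * D <= A].
Proof.
move=> D2 ll1 s1 le A.
have D1 : 1 <= D by lra.
have D4 : 1 <= D ^+ 4 by rewrite exprn_ege1.
have s5 : 1 <= s ^+ 5 by rewrite exprn_ege1.
have Ds : 1 <= D ^+ 4 * s ^+ 5 by rewrite mulr_ege1.
have DsA : D ^+ 4 * s ^+ 5 <= A by rewrite /A ler_peMl //; lra.
have D4A : D ^+ 4 <= A by apply: le_trans DsA; rewrite ler_peMr //; lra.
have ss5 : s <= s ^+ 5 by rewrite [leRHS]exprS ler_peMr ?exprn_ege1 //; lra.
have DD4 : D <= D ^+ 4 by rewrite [leRHS]exprS ler_peMr ?exprn_ege1 //; lra.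
split=> //; first by lra.
- rewrite ler_pdivlMr; last by lra.
  apply: le_trans le.
  have -> : s ^+ 5 * (3072 * 32 * ll * D ^+ 7) = 3072 * 32 * A * D * D ^+ 2.
    by rewrite /A; ring.
  by rewrite ler_peMr ?exprn_ege1 // !mulr_ge0 //; lra.
- by apply: le_trans DsA; apply: le_trans ss5 _; rewrite ler_peMl //; lra.
- by apply: le_trans DsA; rewrite mulrC; apply: ler_pM => //; lra.
Qed.

Lemma inv_le_of_exp5 (D l w : R) : 1 <= D -> 1 <= l -> 0 <= w ->
  w ^+ 5 = D ^+ 7 / l -> l^-1 <= w.
Proof.
move=> D1 l1 w0 w5; have l0 : 0 < l by lra.
rewrite -(@ler_pXn2r _ 5) ?nnegrE ?invr_ge0 ?(ltW l0) // w5 exprVn.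
rewrite ler_pdivlMr // exprS invfM mulrAC mulVf ?gt_eqF // mul1r.
apply: (@le_trans _ _ 1); last by rewrite exprn_ege1.
by rewrite invf_le1 ?exprn_gt0 // exprn_ege1.
Qed.

Lemma collect_bounds (m X J q n l w ll s K : R) :
  0 < K -> 1 <= ll -> 0 <= n -> 0 <= w -> m <= X + J + q ->
  X <= n / l -> q <= 4 * (n / l) -> J <= 2 * ll * n / s + 1 -> 1 <= n / l ->
  l^-1 <= w -> s^-1 <= 2 * (K * ll) * w ->
  m <= (4 * K + 6) * ll ^+ 2 * (n * w).
Proof.
move=> K0 ll1 n0 w0 hm hX hq hJ h1 lw sw.
have nlw : n / l <= n * w by rewrite ler_wpM2l.
have J_w : 2 * ll * n / s <= 4 * K * (ll ^+ 2 * (n * w)).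
  have -> : 4 * K * (ll ^+ 2 * (n * w)) = 2 * ll * n * (2 * (K * ll) * w) by ring.
  by rewrite ler_wpM2l // !mulr_ge0 //; lra.
have llw : n * w <= ll ^+ 2 * (n * w) by rewrite ler_peMl ?mulr_ge0 ?exprn_ege1.
have -> : (4 * K + 6) * ll ^+ 2 * (n * w) =
  4 * K * (ll ^+ 2 * (n * w)) + 6 * (ll ^+ 2 * (n * w)) by ring.
apply: le_trans hm _; apply: le_trans (lerD (lerD hX hJ) hq) _.
move: (le_trans nlw llw) h1 J_w; move: (ll ^+ 2 * _) (n / l) (2 * ll * n / s).
by move=> z c y; clear; lra.
Qed.

End RealArithmetic.

Theorem theorem1p2 (R : realType) :
  exists (C : R) (n0 : nat), 0 < C /\ (0 < n0)%N /\
    forall (n : nat) (G : multigraph n) (Delta : nat),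
      (n0 <= n)%N ->
      graph_connected G ->
      max_degree G = Delta ->
      1 < logb (Delta%:R : R) n%:R ->
      let L : R := logb Delta%:R n%:R in
      let lambda2 : R := lambda R G 2 in
      (eigen_count G `[(1 - ln L / L) * lambda2, lambda2])%:R
        <= C * ln (ln (n%:R : R)) `^ C
           * (n%:R * (Delta%:R `^ (7 / 5) / ln (n%:R : R) `^ (1 / 5))).
Proof.
(* The factor 3072 is the one in [support_count_le]; 32 is the 16 of [k <= L / 16], doubled to
   absorb the rounding of [k]. *)
have [K K_eq] : exists K : R, K = 3072 * 32 by exists (3072 * 32).
have K1 : 1 <= K by rewrite K_eq; lra.
have K0 : 0 < K by exact: lt_le_trans K1.
(* This threshold gives [l >= expR 1 + 256], hence [ll >= 1] and the bound [256 <= l] of the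
   estimates. *)
exists (4 * K + 6), (Num.truncn (expR (expR 1 + 256 : R))).+1.
split; [by lra|split=> // n G Delta hn connG hD]; subst Delta.
set Delta := max_degree G; set D : R := Delta%:R => L1; cbv zeta.
set L : R := logb D n%:R in L1 *; set lambda2 := lambda R G 2.
set m := eigen_count _ _; set l := ln n%:R; set ll := ln l.
have nR : 0 < n%:R :> R by rewrite ltr0n (leq_trans _ hn).
have expl : expR l = n%:R by rewrite lnK.
have l_big : expR 1 + 256 <= l.
  rewrite -ler_expR expl ltW // (lt_le_trans (truncnS_gt _)) // ler_nat.
  exact: hn.
have l_ge : 256 <= l by apply: le_trans l_big; rewrite lerDr expR_ge0.
have l1 : 1 <= l by apply: le_trans l_ge; rewrite ler1n.
have l0 : 0 < l by exact: lt_le_trans l1.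
have ll1 : 1 <= ll.
  by rewrite -ler_expR /ll lnK ?posrE // (le_trans _ l_big) // lerDl.
(* For [Delta] equal to 0 or 1, [ln D = 0] and [logb] takes the value 0, against [L1]. *)
have D2 : (2 <= Delta)%N.
  rewrite ltnNge; apply/negP => D1; have lnD0 : ln D = 0.
    rewrite /D; move: D1; case: (Delta) => [|[|//]] _; last exact: ln1.
    exact: ln0.
  by move: L1; rewrite /L /logb lnD0 invr0 mulr0 ltr10.
have D_ge2 : 2 <= D by rewrite (ler_nat R 2).
have D_ge1 : 1 <= D by apply: le_trans D_ge2; rewrite ler1n.
have D0 : 0 < D by exact: lt_le_trans D_ge1.
pose W := D `^ (7 / 5) / l `^ (1 / 5).
have W0 : 0 < W by rewrite divr_gt0 ?powR_gt0.
have W5 : W ^+ 5 = D ^+ 7 / l by apply: powR_ratio_exp5 => //; apply: ltW.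
(* Exponent 2 on [ll] is enough: [ll >= 1] and [4 * K + 6 >= 2]. *)
suff main : m%:R <= (4 * K + 6) * ll ^+ 2 * (n%:R * W).
  apply: le_trans main _; apply: ler_wpM2r; first exact: mulr_ge0 (ltW nR) (ltW W0).
  apply: ler_wpM2l; first by rewrite addr_ge0 ?mulr_ge0 // ltW.
  rewrite -powR_mulrn; last exact: le_trans ll1.
  by apply: ler_powR => //; move: K1; clear; lra.
have D7 : 0 < D ^+ 7 by rewrite exprn_gt0.
have Kll1 : 1 <= K * ll by rewrite mulr_ege1.
(* If no [s >= 1] satisfies [K ll D^7 s^5 <= l], the claim is weaker than
   [eigen_count G I <= n]. *)
case: (ltrP (l / (K * ll * D ^+ 7)) 1) => [Y1|/fifth_root_approx[s [s0 sY Ys]]].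
  have := exp5_gap (x := 1) Kll1 D7 l0 (ltW W0) ler01 W5.
  rewrite expr1n mul1r => /(_ Y1) KW1.
  apply: (@le_trans _ _ n%:R); first by rewrite ler_nat eigen_count_le_size.
  apply: (@le_trans _ _ (K * ll * W * n%:R)); first by rewrite ler_peMl // ltW.
  have -> : K * ll * W * n%:R = K * ll * (n%:R * W) by ring.
  apply: ler_wpM2r; first exact: mulr_ge0 (ltW nR) (ltW W0).
  apply: ler_pM; rewrite ?(ltW K0) ?(le_trans _ ll1) //.
    by move: K0; clear; lra.
  by rewrite expr2 ler_peMl // (le_trans _ ll1).
have sR : 1 <= s%:R :> R by rewrite ler1n.
have F1 : s%:R ^+ 5 * (K * ll * D ^+ 7) <= l.
  by rewrite -ler_pdivlMr // mulr_gt0 // (lt_le_trans _ Kll1).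
have F2 : s%:R^-1 <= 2 * (K * ll) * W.
  have := exp5_gap Kll1 D7 l0 (ltW W0) (mulr_ge0 (ler0n R 2) (ler0n R s)) W5 Ys.
  rewrite -[s%:R^-1]mul1r ler_pdivrMr ?ltr0n // => /ltW.
  by congr (_ <= _); ring.
rewrite K_eq in F1.
have [A1 lD sA D4A sDA] := support_size_bounds D_ge2 ll1 sR F1.
set A := ll * _ in A1 lD sA D4A sDA.
have lnD0 : 0 < ln D by rewrite ln_gt0 // (lt_le_trans _ D_ge2) // ltr1n.
(* [ln D <= D] trades the logarithm in [L] for a factor [D], so that [lD] makes [k] large enough. *)
have LlD : l / D <= L.
  by rewrite /L /logb ler_wpM2l ?(ltW l0) // lef_pV2 ?posrE // ltW // ln_sublinear.
have L0 : 0 <= L / 16 by rewrite divr_ge0 // (le_trans _ (ltW L1)).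
have /andP[kL Lk] := truncn_itv L0; set k := Num.truncn _ in kL Lk.
have k_ge : 3072 * A <= k%:R.
  by move: Lk A1 lD LlD; rewrite -(@natr1 _ k); clear; lra.
have sk : (s <= k)%N.
  by rewrite -(ler_nat R); move: k_ge sA A1; clear; lra.
have l_D : l / D <= l by rewrite ler_pdivrMr ?ler_peMr // ltW.
have sn : (s + s < n)%N.
  rewrite -(ltr_nat R) natrD; have := ln_sublinear nR; rewrite -/l.
  by move: sA A1 lD l_D; clear; lra.
have D4l : D ^+ 4 <= l.
  by move: D4A A1 lD l_D; clear; lra.
have ball_le := large_ball_le l_ge D2 kL D4l.
have one_le : 1 <= n%:R / l.
  rewrite ler_pdivlMr // mul1r (le_trans _ (_ : l ^+ 3 <= _)) //.
    by rewrite exprS ler_peMr ?exprn_ege1 // ltW.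
  by rewrite -expl cube_le_expR.
have Un : (Delta.+1 ^ (4 * k).+1 < n)%N.
  rewrite -(ltr_nat R) (le_lt_trans ball_le) // ltr_pdivrMr // ltr_pMr //.
  by apply: lt_le_trans l_ge; rewrite ltr1n.
have /andP[eps0 eps1] := eps_bounds L1.
have eps_lt1 : ln L / L < 1 by apply: le_lt_trans eps1 _; rewrite invf_lt1 ?ltr1n.
pose J := (Num.truncn (2 * ll * n%:R / s%:R)).+1.
have J0 : 0 <= 2 * ll * n%:R / s%:R by rewrite !mulr_ge0 ?invr_ge0 // (le_trans _ ll1).
have hJ : 2 * ll * n%:R / s%:R <= J%:R by rewrite ltW // truncnS_gt.
have J_le : J%:R <= 2 * ll * n%:R / s%:R + 1.
  by rewrite /J -[_.+1%:R]natr1 lerD2r truncn_le.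
have h1 : ((s * Delta).+1 ^ s)%:R / ((1 + gain R Delta (s + s)) ^+ s) ^+ k.*2 <= l ^- 2.
  apply: support_count_le => //; first exact: leq_trans D2.
    by rewrite -/D -/l; move: sDA A1 lD l_D; clear; lra.
  by rewrite -/D -/l -/ll; move: k_ge; rewrite /A !mulrA.
have h2 : (1 - s%:R / n%:R) ^+ J <= l ^- 2.
  apply: miss_probability_le => //.
  by rewrite ltnW // (leq_ltn_trans _ sn) ?leq_addr.
have h3 := interval_loss_le l_ge D2 kL L1.
apply: (collect_bounds K0 ll1 (ltW nR) (ltW W0)
  (eigen_count_le connG J s0 sk sn Un eps0 eps_lt1) ball_le _ J_le one_le
  (inv_le_of_exp5 D_ge1 l1 (ltW W0) W5) F2).
apply: (@le_trans _ _ (n%:R * (l ^- 2 + l ^- 2) * (2 * l))); last first.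
  have -> // (c x : R) : 0 < x -> c * (x ^- 2 + x ^- 2) * (2 * x) = 4 * (c / x).
  by move=> x0; field; rewrite gt_eqF.
have dl0 : 0 <= n%:R * (l ^- 2 + l ^- 2).
  by rewrite mulr_ge0 ?(ltW nR) // addr_ge0 // invr_ge0 exprn_ge0 // ltW.
apply: (@le_trans _ _ (n%:R * (l ^- 2 + l ^- 2) / (1 - ln L / L) ^+ k.*2)).
  rewrite ler_wpM2r ?invr_ge0 ?exprn_ge0 ?subr_ge0 ?(ltW eps_lt1) //.
  by rewrite ler_wpM2l ?(ltW nR) // lerD.
by rewrite ler_wpM2l.
Qed.
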